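(* Let $N\ge1$, let $V_1,V_2$ satisfy condition (VH1) and let $G$ be of the form (G) (both described in the context), with $p_1\le p_i$, $q_1\le q_j$, $r_{1,1}\le r_{1,k}$, $r_{2,1}\le r_{2,k}$ for all $i,j,k\ge1$. Let $0<\lambda_1\le\lambda_2$. Suppose that $(u_1,u_2)\ne(0,0)$ is a nonnegative solution in $\mathcal H$ of $$\begin{cases}-\Delta u_1+V_1(x)u_1+\lambda_1u_1=\partial_1G(u_1,u_2)&\text{in }\mathbb R^N,\\-\Delta u_2+V_2(x)u_2+\lambda_2u_2=\partial_2G(u_1,u_2)&\text{in }\mathbb R^N,\end{cases}$$ and $(\omega_1,\omega_2)\neq(0,0)$ is a nonnegative solution in $\mathcal H$ of $$\begin{cases}-\Delta\omega_1+\lambda_1\omega_1=\partial_1G(\omega_1,\omega_2)&\text{in }\mathbb R^N,\\-\Delta\omega_2+\lambda_2\omega_2=\partial_2G(\omega_1,\omega_2)&\text{in }\mathbb R^N.\end{cases}$$ Then there exists $(\phi_1,\phi_2)\in\mathcal H$ such that $$(\|\phi_1\|_2^2,\|\phi_2\|_2^2)=(\|u_1\|_2^2+\|\omega_1\|_2^2,\ \|u_2\|_2^2+\|\omega_2\|_2^2)\quad\text{and}\quad J[\phi_1,\phi_2]<J[u_1,u_2]+I[\omega_1,\omega_2].$$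
   Context: $\mathcal H=H^1(\mathbb R^N)\times H^1(\mathbb R^N)$ (real-valued functions); $\|\cdot\|_2$ is the $L^2(\mathbb R^N)$ norm; solutions are understood in the weak sense. Form (G): $G(s,t)=\sum_{i=1}^{\ell}\frac{\mu_i}{p_i}|s|^{p_i}+\sum_{j=1}^{m}\frac{\nu_j}{q_j}|t|^{q_j}+\sum_{k=1}^{n}\beta_k|s|^{r_{1,k}}|t|^{r_{2,k}}$, where $\ell,m,n$ are positive integers and, for all $i,j,k$, $\mu_i,\nu_j,\beta_k>0$, $2<p_i,\,q_j,\,r_{1,k}+r_{2,k}<2+\frac4N$, $r_{1,k},r_{2,k}>1$. Condition (VH1): for $\iota=1,2$, $V_\iota:\mathbb R^N\to\mathbb R$ is measurable, $V_\iota(x)\le 0$ in $\mathbb R^N$, $\lim_{|x|\to\infty}V_\iota(x)=0$, and there exist $\sigma_\iota\in[0,1)$ and $\tau_\iota\ge0$ such that $\|u\|_{V_\iota}^2\le\sigma_\iota\|\nabla u\|_2^2+\tau_\iota\|u\|_2^2$ for all $u\in H^1(\mathbb R^N)\cap L^2(\mathbb R^N,-V_\iota(x)\,dx)$, where $\|u\|_{V_\iota}:=\left(\int_{\mathbb R^N}-V_\iota|u|^2dx\right)^{1/2}$. Under this assumption the form $\langle u,v\rangle_{V_\iota}=\int_{\mathbb R^N}-V_\iota uv\,dx$ is regarded as defined and finite on $H^1(\mathbb R^N)$. Functionals: $I[u_1,u_2]=\frac12\sum_{\iota=1}^2\|\nabla u_\iota\|_2^2-\int_{\mathbb R^N}G(u_1,u_2)\,dx$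 and $J[u_1,u_2]=I[u_1,u_2]+\frac12\sum_{\iota=1}^2\int_{\mathbb R^N}V_\iota(x)u_\iota^2\,dx$. *)

(* Defs.v *)
From HB Require Import structures.
From mathcomp Require Import all_boot all_order all_algebra.
From mathcomp Require Import all_classical all_reals all_analysis.

Set Implicit Arguments.
Unset Strict Implicit.
Unset Printing Implicit Defensive.

Import Order.TTheory GRing.Theory Num.Theory.
Import numFieldNormedType.Exports.

Local Open Scope classical_set_scope.
Local Open Scope ring_scope.

(* The library has normed spaces of row vectors, but no sigma-algebra on them
   and no N-dimensional Lebesgue measure; both are built here, so that
   'rV[R]_N carries the derivatives and the integrals at the same time.  The
   sigma-algebra is the product (Borel) one, exactly as the library does it
   for n.-tuple T. *)
Definition measure_row_display : measure_display -> measure_display.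
Proof. exact. Qed.

Section measurable_row.
Context {d} {T : measurableType d}.
Variable n : nat.

Let coors : 'I_n -> 'rV[T]_n -> T := fun i x => x ord0 i.

Let row_set0 : g_sigma_preimage coors set0.
Proof. exact: sigma_algebra0. Qed.

Let row_setC A : g_sigma_preimage coors A -> g_sigma_preimage coors (~` A).
Proof. exact: sigma_algebraC. Qed.

Let row_bigcup (F : _^nat) : (forall i, g_sigma_preimage coors (F i)) ->
  g_sigma_preimage coors (\bigcup_i (F i)).
Proof. exact: sigma_algebra_bigcup. Qed.

HB.instance Definition _ := @isMeasurable.Build (measure_row_display d)
  'rV[T]_n (g_sigma_preimage coors) row_set0 row_setC row_bigcup.

End measurable_row.

Section measurable_row_theory.
Context d1 d2 (T1 : measurableType d1) (T2 : measurableType d2).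

Lemma measurable_row_coord n (i : 'I_n) :
  measurable_fun [set: 'rV[T2]_n] (fun x : 'rV[T2]_n => x ord0 i).
Proof.
move=> _ Y mY; rewrite setTI; apply: sub_sigma_algebra => /=.
rewrite -bigcup_seq/=; exists i => /=; first by rewrite mem_index_enum.
by exists Y => //; rewrite setTI.
Qed.

Lemma measurable_fun_rowP n (f : T1 -> 'rV[T2]_n) :
  measurable_fun [set: T1] f <->
  forall i, measurable_fun [set: T1] (fun x => f x ord0 i).
Proof.
split=> [mf i|mf].
  exact: (measurableT_comp (measurable_row_coord i) mf).
have sub : g_sigma_preimage (fun i (x : T1) => f x ord0 i) `<=` measurable.
  apply: smallest_sub; first exact: sigma_algebra_measurable.
  rewrite -bigcup_seq/= => A [i _ [B mB <-]].
  exact: mf.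
move=> _ A mA; rewrite setTI; apply: sub.
rewrite [X in X _](g_sigma_preimage_comp (fun i (x : 'rV[T2]_n) => x ord0 i) f).
by exists A => //; rewrite setTI.
Qed.

End measurable_row_theory.

(* [lebesgue_measure] lives on [measurableTypeR R], which is [R] with a
   different display; hence the type of the first component. *)
Section row_cons.
Context (R : realType) (n : nat).
Let mR_id : measurable_fun [set: measurableTypeR R] (id : measurableTypeR R -> R).
Proof. by move=> _ A mA; rewrite setTI. Qed.

Let R_mid : measurable_fun [set: R] (id : R -> measurableTypeR R).
Proof. by move=> _ A mA; rewrite setTI. Qed.

Definition row_cons (z : measurableTypeR R * 'rV[R]_n) : 'rV[R]_n.+1 :=
  \row_j oapp (z.2 ord0) z.1 (unlift ord0 j).

Definition row_uncons (x : 'rV[R]_n.+1) : measurableTypeR R * 'rV[R]_n :=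
  (x ord0 ord0, \row_j x ord0 (lift ord0 j)).

Lemma row_consK : cancel row_cons row_uncons.
Proof.
move=> [a y]; congr pair; first by rewrite mxE unlift_none.
by apply/rowP => j; rewrite !mxE liftK.
Qed.

Lemma measurable_row_cons :
  measurable_fun [set: measurableTypeR R * 'rV[R]_n] row_cons.
Proof.
apply/measurable_fun_rowP => i; case: (unliftP ord0 i) => [j ->|->].
  under eq_fun do rewrite mxE liftK/=.
  exact: (measurableT_comp (measurable_row_coord j) measurable_snd).
under eq_fun do rewrite mxE unlift_none/=.
exact: (measurableT_comp mR_id measurable_fst).
Qed.

Lemma measurable_row_uncons : measurable_fun [set: 'rV[R]_n.+1] row_uncons.
Proof.
apply: measurable_fun_pair.
  exact: (measurableT_comp R_mid (measurable_row_coord ord0)).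
apply/measurable_fun_rowP => i; under eq_fun do rewrite mxE.
exact: measurable_row_coord.
Qed.

End row_cons.

Section lebesgue_row_step.
Context (R : realType) (n : nat).
Variable mu : {sigma_finite_measure set 'rV[R]_n -> \bar R}.

Definition lebesgue_row_step : set 'rV[R]_n.+1 -> \bar R :=
  pushforward (@lebesgue_measure R \x mu)%E (@row_cons R n).

Let step : {measure set 'rV[R]_n.+1 -> \bar R} :=
  measure_function_pushforward__canonical__measure_function_Measure
    (@lebesgue_measure R \x mu)%E (@measurable_row_cons R n).

HB.instance Definition _ := isMeasure.Build _ _ _ lebesgue_row_step
  (measure0 step) (measure_ge0 step) (@measure_semi_sigma_additive _ _ _ step).

Let step_sigma_finite : sigma_finite setT lebesgue_row_step.
Proof.
have /sigma_finiteP[F [TF ndF Foo]] := sigma_finiteT (@lebesgue_measure R).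
have /sigma_finiteP[G [TG ndG Goo]] := sigma_finiteT mu.
exists (fun k => @row_uncons R n @^-1` (F k `*` G k)).
  rewrite -preimage_bigcup (_ : \bigcup_k _ = setT) ?preimage_setT//.
  apply/seteqP; split=> // -[x y] _.
  have [i _ Fix] : (\bigcup_i F i) x by rewrite -TF.
  have [j _ Gjy] : (\bigcup_i G i) y by rewrite -TG.
  exists (maxn i j) => //; split.
    by move: x Fix; exact/subsetPset/ndF/leq_maxl.
  by move: y Gjy; exact/subsetPset/ndG/leq_maxr.
move=> k; have [mF Fk] := Foo k; have [mG Gk] := Goo k; split.
  rewrite -[X in measurable X]setTI; apply: measurable_row_uncons => //.
  exact: measurableX.
rewrite /lebesgue_row_step /pushforward -comp_preimage.
rewrite (_ : _ \o _ = id); last by apply/funext => z; exact: row_consK.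
by rewrite preimage_id product_measure1E// lte_mul_pinfty// ge0_fin_numE.
Qed.

HB.instance Definition _ := Measure_isSigmaFinite.Build _ _ _ lebesgue_row_step
  step_sigma_finite.

End lebesgue_row_step.

Fixpoint lebesgue_row {R : realType} (n : nat) :
    {sigma_finite_measure set 'rV[R]_n -> \bar R} :=
  match n with
  | 0 => \d_(0 : 'rV[R]_0)
  | n'.+1 => lebesgue_row_step (lebesgue_row n')
  end.

Lemma lebesgue_row_box (R : realType) n (A : 'I_n -> set R) :
  (forall i, measurable (A i)) ->
  lebesgue_row n [set x | forall i, A i (x ord0 i)] =
  (\prod_(i < n) @lebesgue_measure R (A i))%E.
Proof.
elim: n A => [A _|n IH A mA].
  by rewrite big_ord0/= diracE mem_set// => -[].
rewrite big_ord_recl -IH//=.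
rewrite /lebesgue_row_step /pushforward.
pose B : set 'rV[R]_n := [set y | forall i, A (lift ord0 i) (y ord0 i)].
have mB : measurable B.
  rewrite (_ : B = \bigcap_(i in [set: 'I_n])
      ((fun y : 'rV[R]_n => y ord0 i) @^-1` A (lift ord0 i))).
    apply: fin_bigcap_measurable => // i _.
    rewrite -[X in measurable X]setTI; exact: measurable_row_coord.
  by apply/seteqP; split=> [y Ay i _|y Ay i]; exact: Ay.
rewrite -[RHS](product_measure1E (@lebesgue_measure R) (lebesgue_row n))//; last exact: mA.
congr (_ _); apply/seteqP; split=> [[a y] /= H|[a y] /= [Aa Ay] i].
  split=> [|i]; first by have := H ord0; rewrite mxE unlift_none.
  by have := H (lift ord0 i); rewrite mxE liftK.
by rewrite mxE; case: (unliftP ord0 i) => [j|] ->.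
Qed.

Section euclidean.
Context (R : realType) (N : nat).
Implicit Types x y : 'rV[R]_N.

Definition dot x y : R := \sum_(i < N) x ord0 i * y ord0 i.

(* The library norm on 'rV[R]_N is the sup norm. *)
Definition enorm x : R := Num.sqrt (dot x x).

End euclidean.

Arguments enorm {R N} x.

Section sobolev.
Context (R : realType) (N : nat).
Local Notation leb := (@lebesgue_row R N).
Implicit Types (u v f V : 'rV[R]_N -> R).

(* Measurability for the completed (Lebesgue) sigma-algebra: [measurable_fun]
   alone is Borel measurability. *)
Definition lebesgue_measurable f : Prop :=
  exists2 g : 'rV[R]_N -> R, measurable_fun [set: 'rV[R]_N] g &
    {ae leb, forall x, f x = g x}.

Definition spaceL2 : set ('rV[R]_N -> R) := [set u | u \in Lfun leb 2%:E].

Definition normL2 u : R := fine ('N[leb]_2%:E[EFin \o u])%E.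

(* Every iterated directional derivative is differentiable everywhere. *)
Definition smooth f : Prop := forall (s : seq 'rV[R]_N) (x : 'rV[R]_N),
  differentiable (foldr (fun e g y => 'D_e g y) f s) x.

Definition test_function f : Prop :=
  smooth f /\ compact (closure [set x | f x != 0]).

Definition weak_partial (i : 'I_N) u v : Prop := forall phi,
  test_function phi ->
  \int[leb]_x (u x * 'D_(delta_mx ord0 i) phi x) =
  - \int[leb]_x (v x * phi x).

Definition sobolevH1 : set ('rV[R]_N -> R) :=
  [set u | spaceL2 u /\ forall i, exists2 v, spaceL2 v & weak_partial i u v].

(* Weak gradient of [u] in H^1; unique up to a null set, with a fixed choice
   of representative. *)
Definition grad u (x : 'rV[R]_N) : 'rV[R]_N :=
  \row_i xget (fun=> 0) [set v | spaceL2 v /\ weak_partial i u v] x.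

Definition normV V u : R := Num.sqrt (\int[leb]_x (- V x * u x ^+ 2)).

(* [u] in L^2(R^N, - V dx), for measurable [u] and [V <= 0]. *)
Definition L2_weight V u : Prop :=
  (\int[leb]_x (- V x * u x ^+ 2)%:E < +oo)%E.

(* The last clause is the convention that the quadratic form of [V] is defined
   and finite on H^1. *)
Definition VH1 V : Prop :=
  [/\ lebesgue_measurable V,
      forall x, V x <= 0,
      forall e : R, 0 < e ->
        exists M : R, forall x, M < enorm x -> `|V x| < e,
      exists sigma tau : R, [/\ 0 <= sigma < 1, 0 <= tau &
        forall u, sobolevH1 u -> L2_weight V u ->
          normV V u ^+ 2 <=
          sigma * normL2 (enorm \o grad u) ^+ 2 + tau * normL2 u ^+ 2] &
      forall u, sobolevH1 u -> L2_weight V u].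

(* - Delta u + V u + lambda u = f, tested against H^1. *)
Definition weak_sol V (lambda : R) f u : Prop := forall phi, sobolevH1 phi ->
  \int[leb]_x dot (grad u x) (grad phi x) + \int[leb]_x (V x * u x * phi x)
  + lambda * \int[leb]_x (u x * phi x) = \int[leb]_x (f x * phi x).

Section system.
Variable G : R -> R -> R.

Definition partial1 (s t : R) : R := derive1 (G ^~ t) s.
Definition partial2 (s t : R) : R := derive1 (G s) t.

(* A nonnegative nonzero H^1 solution of the system with potentials [V1], [V2];
   functions in H^1 are compared almost everywhere. *)
Definition nonneg_nonzero_solution V1 V2 (lambda1 lambda2 : R) u1 u2 : Prop :=
  [/\ sobolevH1 u1 /\ sobolevH1 u2,
      ~ ({ae leb, forall x, u1 x = 0} /\ {ae leb, forall x, u2 x = 0}),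
      {ae leb, forall x, 0 <= u1 x} /\ {ae leb, forall x, 0 <= u2 x},
      weak_sol V1 lambda1 (fun x => partial1 (u1 x) (u2 x)) u1 &
      weak_sol V2 lambda2 (fun x => partial2 (u1 x) (u2 x)) u2].

Definition energyI u1 u2 : R :=
  2^-1 * (normL2 (enorm \o grad u1) ^+ 2 + normL2 (enorm \o grad u2) ^+ 2)
  - \int[leb]_x G (u1 x) (u2 x).

Definition energyJ V1 V2 u1 u2 : R :=
  energyI u1 u2 + 2^-1 * (\int[leb]_x (V1 x * u1 x ^+ 2)
                    + \int[leb]_x (V2 x * u2 x ^+ 2)).

End system.
End sobolev.

Section nonlinearity.
Context (R : realType) (l m n : nat).
(* l.+1, m.+1 and n.+1 terms, so that each sum is nonempty and [ord0] is the
   first index. *)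
Variables (mu p : 'I_l.+1 -> R) (nu q : 'I_m.+1 -> R).
Variables (beta r1 r2 : 'I_n.+1 -> R).

Definition formG (s t : R) : R :=
  \sum_(i < l.+1) mu i / p i * `|s| `^ p i
  + \sum_(j < m.+1) nu j / q j * `|t| `^ q j
  + \sum_(k < n.+1) beta k * `|s| `^ r1 k * `|t| `^ r2 k.

Definition condG (N : nat) : Prop :=
  [/\ forall i, 0 < mu i /\ 2 < p i < 2 + 4 / N%:R,
      forall j, 0 < nu j /\ 2 < q j < 2 + 4 / N%:R &
      forall k, [/\ 0 < beta k, 1 < r1 k, 1 < r2 k &
        2 < r1 k + r2 k < 2 + 4 / N%:R]].

End nonlinearity.

(* Main.v *)
Require Import Defs.
From mathcomp Require Import all_boot all_order all_algebra.
From mathcomp Require Import all_classical all_reals all_analysis.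
From mathcomp Require Import measurable_realfun.
From mathcomp Require Import ring lra.
Import Order.TTheory GRing.Theory Num.Theory.
Import numFieldNormedType.Exports.
Local Open Scope classical_set_scope.
Local Open Scope ring_scope.
Set Implicit Arguments.
Unset Strict Implicit.
Unset Printing Implicit Defensive.

(* Take phi_i = sqrt(u_i^2 + w_i(. + y)^2).  The masses add up exactly.  As
   V_i <= 0, the potential energy of phi_i is at most that of u_i.  Since the
   Euclidean norm is 1-Lipschitz, the difference quotients of phi_i are dominated
   in L2 by those of the pair (u_i, w_i), hence |grad phi_i|_2^2 is at most
   |grad u_i|_2^2 + |grad w_i|_2^2.  Finally G is superadditive along this
   construction, strictly at the points where neither (u_1, u_2) nor
   (w_1, w_2)(. + y) vanishes; by Fubini these points have positive measure for
   some y, so no maximum principle is needed.  Finiteness of the integrals of G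
   comes from the weak-type bound |{|u| > t}| <= C t^(-2-4/N) on H^1. *)

(** * Square integrable functions *)

(** The weak gradient [grad] is a chosen representative, known only through its pairings with test
    functions. Gradient estimates therefore go by duality, which takes test functions that are
    smooth by construction and dense in L2, and an equivalence between bounds on a weak derivative
    and bounds on L2 translation differences. This equivalence carries the constant 1 of the
    pointwise inequality over to the gradients. That phi_i lies in H^1 is a separate matter: a
    square integrable weak derivative has to be exhibited.

    Real integrals are [fine] of extended ones, so an infinite integral counts as 0; hence the need
    to know that G is integrable along H^1 pairs. The exponent 2 + 4/N is a balance: a cube of
    volume of order t^(-2) cannot be filled by values of size t, since the L2 mass is bounded; its
    side is of order t^(-2/N), translations by that side change u by t^(-4/N) in squared L2 norm,
    and Chebyshev supplies another t^(-2).

    The shift y serves strictness: where one of the two pairs vanishes, G is exactly additive. *)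

Section square_integrable.
Context d (T : measurableType d) (R : realType) (mu : {measure set T -> \bar R}).
Implicit Types f g h : T -> R.

Local Notation L2 := (Lfun mu 2%:E).

Lemma Lfun2P f : f \in L2 <-> measurable_fun setT f /\
  mu.-integrable setT (EFin \o (fun x => f x ^+ 2)).
Proof.
split=> [Lf|[mf If]].
  by split; [move: Lf; rewrite inE => /andP[/[!inE]]|exact: Lfun2_integrable_sqr].
rewrite inE; apply/andP; split; rewrite inE//= /finite_norm unlock.
apply: poweR_lty; case/integrableP: If => _; apply: le_lt_trans.
rewrite le_eqVlt; apply/orP; left; apply/eqP; apply: eq_integral => x _ /=.
by rewrite powR_mulrn ?normr_ge0// normrX.
Qed.

Lemma Lfun2_measurable f : f \in L2 -> measurable_fun setT f.
Proof. by move/Lfun2P => -[]. Qed.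

Lemma Lfun2_mul f g : f \in L2 -> g \in L2 ->
  mu.-integrable setT (EFin \o (fun x => f x * g x)).
Proof. by move=> Lf Lg; apply/Lfun1_integrable/Lfun2_mul_Lfun1. Qed.

Lemma Lfun2_dominated f g : measurable_fun setT f -> g \in L2 ->
  (forall x, `|f x| <= `|g x|) -> f \in L2.
Proof.
move=> mf /Lfun2P[mg Ig] fg; apply/Lfun2P; split => //.
apply: le_integrable Ig => //; first exact/measurable_EFinP/measurable_funX.
move=> x _ /=; rewrite lee_fin !normrX; apply: lerXn2r; rewrite ?nnegrE//.
Qed.

Lemma Lfun2D f g : f \in L2 -> g \in L2 -> (fun x => f x + g x) \in L2.
Proof.
move=> /[dup] Lf /Lfun2P[mf If] /[dup] Lg /Lfun2P[mg Ig].
apply/Lfun2P; split; first exact: measurable_funD.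
have Ifg := Lfun2_mul Lf Lg.
rewrite (_ : _ \o _ = (fun x => (f x ^+ 2)%:E + (f x * g x)%:E + (f x * g x)%:E
  + (g x ^+ 2)%:E)%E); last by apply/funext => x /=; congr EFin; ring.
apply: integrableD => //; apply: integrableD => //; exact: integrableD.
Qed.

Lemma Lfun2Z a f : f \in L2 -> (fun x => a * f x) \in L2.
Proof.
move=> /Lfun2P[mf If]; apply/Lfun2P; split; first exact: measurable_funM.
rewrite (_ : _ \o _ = (fun x => (a ^+ 2)%:E * (f x ^+ 2)%:E)%E); last first.
  by apply/funext => x /=; congr EFin; ring.
exact: integrableZl.
Qed.

Lemma Lfun2B f g : f \in L2 -> g \in L2 -> (fun x => f x - g x) \in L2.
Proof.
move=> Lf Lg; rewrite (_ : (fun _ => _) = (fun x => f x + -1 * g x)).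
  by apply: Lfun2D => //; exact: Lfun2Z.
by apply/funext => x; rewrite mulN1r.
Qed.

Lemma Lfun2_bounded_mul M f g : measurable_fun setT f -> g \in L2 ->
  (forall x, `|f x| <= M) -> (fun x => f x * g x) \in L2.
Proof.
move=> mf Lg fM; apply: (@Lfun2_dominated _ (fun x => M * g x)).
- by apply: measurable_funM => //; exact: Lfun2_measurable.
- exact: Lfun2Z.
by move=> x; rewrite !normrM ler_wpM2r// (le_trans (fM x))// ler_norm.
Qed.

Lemma Lfun2_sum (I : Type) (s : seq I) (F : I -> T -> R) :
  (forall i, F i \in L2) -> (fun x => \sum_(i <- s) F i x) \in L2.
Proof.
move=> LF; elim: s => [|i s IH].
  rewrite (_ : (fun _ => _) = cst 0); last by apply/funext => x; rewrite big_nil.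
  apply/Lfun2P; split => //.
  rewrite (_ : _ \o _ = cst 0%E); first exact: integrable0.
  by apply/funext => x /=; rewrite expr0n.
rewrite (_ : (fun _ => _) = (fun x => F i x + \sum_(j <- s) F j x)).
  exact: Lfun2D.
by apply/funext => x; rewrite big_cons.
Qed.

Lemma Lfun2_indic (A : set T) : measurable A -> (mu A < +oo)%E ->
  (\1_A : T -> R) \in L2.
Proof.
move=> mA Aoo; apply/Lfun2P; split; first exact: measurable_indic.
rewrite (_ : _ \o _ = EFin \o \1_A).
  apply/integrableP; split; first exact/measurable_EFinP/measurable_indic.
  under eq_integral do rewrite /= ger0_norm//.
  by rewrite integral_indic// setIT.
by apply/funext => x; rewrite /= indicE; case: (x \in A); rewrite ?expr1n ?expr0n.
Qed.

(** A real-valued inner product and norm, on which Hilbert space arguments run; [Lnorm2_sqr] links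
    them to the extended-valued ['N[mu]_2%:E]. *)
Definition inner f g : R := \int[mu]_x (f x * g x).
Definition norm2 f : R := Num.sqrt (inner f f).

Lemma ipC f g : inner f g = inner g f.
Proof. by apply: eq_Rintegral => x _; rewrite mulrC. Qed.

Lemma ipDl f g h : f \in L2 -> g \in L2 -> h \in L2 ->
  inner (fun x => f x + g x) h = inner f h + inner g h.
Proof.
move=> Lf Lg Lh; rewrite -RintegralD//; try exact: Lfun2_mul.
by apply: eq_Rintegral => x _; rewrite mulrDl.
Qed.

Lemma ipDr f g h : f \in L2 -> g \in L2 -> h \in L2 ->
  inner h (fun x => f x + g x) = inner h f + inner h g.
Proof. by move=> *; rewrite ipC ipDl// ![inner _ h]ipC. Qed.

Lemma ipZl a f g : f \in L2 -> g \in L2 ->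
  inner (fun x => a * f x) g = a * inner f g.
Proof.
move=> Lf Lg; rewrite -RintegralZl//; try exact: Lfun2_mul.
by apply: eq_Rintegral => x _; rewrite mulrA.
Qed.

Lemma ipZr a f g : f \in L2 -> g \in L2 ->
  inner g (fun x => a * f x) = a * inner g f.
Proof. by move=> *; rewrite ipC ipZl// [inner _ g]ipC. Qed.

Lemma ipBl f g h : f \in L2 -> g \in L2 -> h \in L2 ->
  inner (fun x => f x - g x) h = inner f h - inner g h.
Proof.
move=> Lf Lg Lh; rewrite -RintegralB//; try exact: Lfun2_mul.
by apply: eq_Rintegral => x _; rewrite mulrBl.
Qed.

Lemma ipBr f g h : f \in L2 -> g \in L2 -> h \in L2 ->
  inner h (fun x => f x - g x) = inner h f - inner h g.
Proof. by move=> *; rewrite ipC ipBl// ![inner _ h]ipC. Qed.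

Lemma ip_suml (I : Type) (s : seq I) (F : I -> T -> R) h :
  (forall i, F i \in L2) -> h \in L2 ->
  inner (fun x => \sum_(i <- s) F i x) h = \sum_(i <- s) inner (F i) h.
Proof.
move=> LF Lh; elim: s => [|i s IH].
  rewrite big_nil /inner /Rintegral (_ : (fun x => _) = cst 0%E) ?integral0//.
  by apply/funext => x; rewrite big_nil mul0r.
rewrite big_cons -IH -ipDl//; last exact: Lfun2_sum.
by apply: eq_Rintegral => x _; rewrite big_cons.
Qed.

Lemma ip_ge0 f : 0 <= inner f f.
Proof. by apply: Rintegral_ge0 => x _; rewrite -expr2 sqr_ge0. Qed.

Lemma n2_ge0 f : 0 <= norm2 f. Proof. exact: sqrtr_ge0. Qed.

Lemma n2_sqr f : norm2 f ^+ 2 = inner f f.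
Proof. by rewrite sqr_sqrtr// ip_ge0. Qed.

Lemma n2_sqrE f : norm2 f ^+ 2 = \int[mu]_x (f x ^+ 2).
Proof. by rewrite n2_sqr; apply: eq_Rintegral => x _; rewrite expr2. Qed.

Lemma n2_sqr_EFin f : f \in L2 ->
  (\int[mu]_x (f x ^+ 2)%:E)%E = (norm2 f ^+ 2)%:E.
Proof.
move=> /Lfun2P[mf If]; rewrite n2_sqrE /Rintegral fineK//.
exact: integrable_fin_num.
Qed.

Lemma cauchy_schwarz f g : f \in L2 -> g \in L2 ->
  `|inner f g| <= norm2 f * norm2 g.
Proof.
move=> Lf Lg.
have E t : 0 <= inner f f - 2 * t * inner f g + t ^+ 2 * inner g g.
  have := ip_ge0 (fun x => f x - t * g x).
  have Lt := Lfun2Z t Lg.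
  by rewrite ipBl// ?ipBr// ?ipZl// ?ipZr//; [|exact: Lfun2B]; rewrite (ipC g f); lra.
suff H : inner f g ^+ 2 <= inner f f * inner g g.
  by rewrite -sqrtrM ?ip_ge0// -sqrtr_sqr ler_wsqrtr.
have [g0|g0] := eqVneq (inner g g) 0.
  suff -> : inner f g = 0 by rewrite expr0n/= mulr_ge0 ?ip_ge0.
  apply/eqP; apply/negPn/negP => fg0.
  (* When [inner g g = 0] the quadratic in t is affine; at this t it equals -1. *)
  have := E ((inner f f + 1) / (2 * inner f g)).
  have -> : 2 * ((inner f f + 1) / (2 * inner f g)) * inner f g = inner f f + 1 by field.
  by rewrite g0; lra.
have gp : 0 < inner g g by rewrite lt_def g0 ip_ge0.
(* The minimiser of the quadratic. *)
have := E (inner f g / inner g g).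
rewrite (_ : _ + _ = inner f f - inner f g ^+ 2 / inner g g); last by field.
by rewrite subr_ge0 ler_pdivrMr.
Qed.

Lemma n2D f g : f \in L2 -> g \in L2 -> norm2 (fun x => f x + g x) <= norm2 f + norm2 g.
Proof.
move=> Lf Lg; have Lfg := Lfun2D Lf Lg.
rewrite -(@ler_pXn2r _ 2)// ?nnegrE ?n2_ge0//; last by rewrite addr_ge0 ?n2_ge0.
rewrite n2_sqr ipDl// !ipDr// (ipC g f) sqrrD !n2_sqr.
have := le_trans (ler_norm _) (cauchy_schwarz Lf Lg).
by rewrite -mulr_natl; lra.
Qed.

Lemma n2Z a f : f \in L2 -> norm2 (fun x => a * f x) = `|a| * norm2 f.
Proof.
move=> Lf; have La := Lfun2Z a Lf.
by rewrite /norm2 ipZl// ipZr// mulrA -expr2 sqrtrM ?sqr_ge0// sqrtr_sqr.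
Qed.

Lemma n2B f g : f \in L2 -> g \in L2 -> norm2 (fun x => f x - g x) <= norm2 f + norm2 g.
Proof.
move=> Lf Lg; rewrite (_ : (fun _ => _) = (fun x => f x + -1 * g x)).
  apply: le_trans (n2D Lf (Lfun2Z (-1) Lg)) _.
  by rewrite n2Z// normrN1 mul1r.
by apply/funext => x; rewrite mulN1r.
Qed.

Lemma le_n2 f g : f \in L2 -> g \in L2 ->
  (forall x, `|f x| <= `|g x|) -> norm2 f <= norm2 g.
Proof.
move=> /Lfun2P[_ If] /Lfun2P[_ Ig] fg.
rewrite -(@ler_pXn2r _ 2)// ?nnegrE ?n2_ge0// !n2_sqrE.
apply: le_Rintegral => // x _; rewrite -[leLHS]real_normK ?num_real//.
by rewrite -[leRHS]real_normK ?num_real// lerXn2r ?nnegrE.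
Qed.

Lemma n2_sum (I : Type) (s : seq I) (F : I -> T -> R) : (forall i, F i \in L2) ->
  norm2 (fun x => \sum_(i <- s) F i x) <= \sum_(i <- s) norm2 (F i).
Proof.
move=> LF; elim: s => [|i s IH].
  rewrite big_nil (_ : (fun _ => _) = cst 0).
    rewrite /norm2 /inner /Rintegral (_ : (fun x => _) = cst 0%E) ?integral0 ?sqrtr0//.
    by apply/funext => x /=; rewrite mul0r.
  by apply/funext => x; rewrite big_nil.
rewrite big_cons (_ : (fun _ => _) = (fun x => F i x + \sum_(j <- s) F j x)).
  by apply: le_trans (n2D (LF i) (@Lfun2_sum _ s _ LF)) _; rewrite lerD2l.
by apply/funext => x; rewrite big_cons.
Qed.

(** Dominated convergence for |f - f_n|^2, which is at most (2 g)^2. A single good index for each e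
    is all that a density argument asks for. *)
Lemma n2_dominated_cvg (f_ : nat -> T -> R) f g : (forall n, f_ n \in L2) ->
  g \in L2 -> (forall n x, `|f_ n x| <= `|g x|) ->
  (forall x, f_ ^~ x @ \oo --> f x) ->
  f \in L2 /\ forall e, 0 < e -> exists n, norm2 (fun x => f x - f_ n x) <= e.
Proof.
move=> Lf_ Lg f_g f_f.
have mf : measurable_fun setT f.
  by apply: (@measurable_fun_cvg _ _ _ _ f_) => // n; exact: Lfun2_measurable.
have fg x : `|f x| <= `|g x|.
  have c : `|f_ n x| @[n --> \oo] --> `|f x| by apply: cvg_norm; exact: f_f.
  rewrite -(cvg_lim _ c)//.
  by apply: limr_le; [exact: cvgP c|apply: nearW => n; exact: f_g].
have Lf : f \in L2 by exact: Lfun2_dominated Lg fg.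
split=> // e e0.
have Ld n : (fun x => f x - f_ n x) \in L2 by exact: Lfun2B.
have Lg2 : (fun x => 2 * g x) \in L2 by exact: Lfun2Z.
pose h n x := ((f x - f_ n x) ^+ 2)%:E.
have [] := @dominated_convergence _ _ _ mu setT measurableT h (cst 0%E)
  (fun x => ((2 * g x) ^+ 2)%:E).
- by move=> n; apply/measurable_EFinP/measurable_funX; exact: Lfun2_measurable.
- exact: measurable_cst.
- apply: aeW => x _; rewrite /h.
  have c : (f x - f_ n x) @[n --> \oo] --> (0 : R).
    by rewrite -(subrr (f x)); apply: cvgB; [exact: cvg_cst|exact: f_f].
  have := cvgM c c; rewrite mulr0 => c2; apply: cvg_EFin; first exact: nearW.
  rewrite (_ : fine \o _ = (fun n => (f x - f_ n x) * (f x - f_ n x))); first exact: c2.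
  by apply/funext => n /=; rewrite expr2.
- by case/Lfun2P: Lg2.
- apply: aeW => x n _; rewrite /h /= lee_fin normrX -[leRHS]real_normK ?num_real//.
  apply: lerXn2r; rewrite ?nnegrE//.
  rewrite [leRHS]normrM [`|2|]ger0_norm// mulrDl mul1r.
  by rewrite (le_trans (ler_normB _ _))// lerD.
move=> _ _; rewrite integral0.
have -> : (fun n => \int[mu]_x h n x)%E = (fun n => (norm2 (fun x => f x - f_ n x) ^+ 2)%:E).
  by apply/funext => n; rewrite -n2_sqr_EFin.
move=> /fine_cvgP[_] /cvgrPdist_le /(_ (e ^+ 2)).
rewrite exprn_gt0// => /(_ isT)[n _ /(_ n (leqnn _))] /=.
rewrite sub0r normrN ger0_norm ?sqr_ge0// => H; exists n.
by rewrite -(@ler_pXn2r _ 2) ?nnegrE ?n2_ge0// ltW.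
Qed.

Lemma cvg_ip_dominated (f_ : nat -> T -> R) f g h : (forall n, f_ n \in L2) ->
  g \in L2 -> h \in L2 -> (forall n x, `|f_ n x| <= `|g x|) ->
  (forall x, f_ ^~ x @ \oo --> f x) -> inner (f_ n) h @[n --> \oo] --> inner f h.
Proof.
move=> Lf_ Lg Lh f_g f_f; have [Lf _] := n2_dominated_cvg Lf_ Lg f_g f_f.
have [] := @dominated_convergence _ _ _ mu setT measurableT
  (fun n x => (f_ n x * h x)%:E) (fun x => (f x * h x)%:E)
  (fun x => `|(g x * h x)%:E|%E).
- by move=> n; case/integrableP: (Lfun2_mul (Lf_ n) Lh).
- by case/integrableP: (Lfun2_mul Lf Lh).
- apply: aeW => x _; apply: cvg_EFin; first exact: nearW.
  by apply: cvgMl; exact: f_f.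
- exact: integrable_abse (Lfun2_mul Lg Lh).
- by apply: aeW => x n _; rewrite /= lee_fin !normrM ler_wpM2r.
move=> _ _ H; apply: fine_cvg; rewrite /inner /Rintegral fineK; first exact: H.
exact: integrable_fin_num (Lfun2_mul Lf Lh).
Qed.

Lemma Lnorm2_sqr f : f \in L2 -> fine 'N[mu]_2%:E[EFin \o f]%E ^+ 2 = norm2 f ^+ 2.
Proof.
move=> Lf; have I0 : (0 <= \int[mu]_x `|(EFin \o f) x| `^ 2)%E.
  by apply: integral_ge0 => x _; exact: poweR_ge0.
have E : (\int[mu]_x `|(EFin \o f) x| `^ 2 = (norm2 f ^+ 2)%:E)%E.
  rewrite -n2_sqr_EFin//; apply: eq_integral => x _ /=.
  by rewrite powR_mulrn ?normr_ge0// -normrX ger0_norm// sqr_ge0.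
rewrite unlock E poweR_EFin/= -powR_mulrn ?powR_ge0//.
  by rewrite -powRrM divff// powRr1 ?n2_ge0// powR_mulrn ?n2_ge0.
exact: n2_ge0.
Qed.

End square_integrable.

(** * Lebesgue measure on row vectors *)

Section boxes.
Context (R : realType) (N : nat).
Implicit Types (a b h x : 'rV[R]_N).
Local Notation leb := (@lebesgue_row R N).

(** Open boxes form a pi-system that generates the sigma-algebra. Translation invariance (uniqueness
    of measures) and density in L2 (lambda-systems) are both checked on them. *)
Definition box a b : set 'rV[R]_N := [set x | forall i, a ord0 i < x ord0 i < b ord0 i].

Definition boxes : set (set 'rV[R]_N) := [set A | exists a b, A = box a b].

Definition cube (r : R) : set 'rV[R]_N := box (const_mx (- r)) (const_mx r).

Lemma cubeP r x : cube r x <-> forall i, `|x ord0 i| < r.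
Proof.
by split=> H i; have := H i; rewrite !mxE real_ltr_norml ?num_real.
Qed.

Lemma cube_cover : \bigcup_k cube k%:R = setT.
Proof.
rewrite -subTset => x _.
exists (Num.bound (\sum_(i < N) `|x ord0 i|)) => //; apply/cubeP => i.
have S0 : 0 <= \sum_(i < N) `|x ord0 i| by apply: sumr_ge0.
rewrite (le_lt_trans _ (archi_boundP S0))//.
by rewrite (bigD1 i)//= lerDl sumr_ge0.
Qed.

Lemma setI_closed_boxes : setI_closed boxes.
Proof.
move=> _ _ [a [b ->]] [c [d ->]].
exists (\row_i Num.max (a ord0 i) (c ord0 i)), (\row_i Num.min (b ord0 i) (d ord0 i)).
apply/seteqP; split=> [x [ab cd] i|x H].
  rewrite !mxE gt_max lt_min.
  have [/andP[ax xb] /andP[cx xd]] := (ab i, cd i).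
  by apply/andP; split; apply/andP; split.
by split=> i; have := H i; rewrite !mxE gt_max lt_min => /andP[/andP[? ?] /andP[? ?]]; apply/andP.
Qed.

Lemma measurable_box a b : measurable (box a b).
Proof.
rewrite (_ : box a b = \bigcap_(i in [set: 'I_N])
    ((fun y : 'rV[R]_N => y ord0 i) @^-1` `]a ord0 i, b ord0 i[)).
  apply: fin_bigcap_measurable => // i _.
  rewrite -[X in measurable X]setTI; exact: measurable_row_coord.
by apply/seteqP; split=> [x H i _|x H i]; have /= := H i; rewrite in_itv//=; exact.
Qed.

Lemma measurable_rowE : @measurable _ 'rV[R]_N = <<s boxes >>.
Proof.
apply/seteqP; split; last first.
  apply: smallest_sub; first exact: sigma_algebra_measurable.
  by move=> _ [a [b ->]]; exact: measurable_box.
apply: smallest_sub; first exact: smallest_sigma_algebra.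
rewrite -bigcup_seq/= => _ [i _ [Y mY <-]].
have mi : measurable_fun setT
    (fun x : g_sigma_algebraType boxes => (x : 'rV[R]_N) ord0 i : R).
  apply: (measurability (@RGenOpens.G R)).
    exact: RGenOpens.measurableE.
  move=> _ [_ [r [s ->]] <-]; rewrite setTI.
  (* A slab in one coordinate is not a box, but a countable union of boxes whose other sides are
     ]-k, k[. *)
  rewrite (_ : _ @^-1` _ = \bigcup_k (box
      (\row_j if j == i then r else - k%:R) (\row_j if j == i then s else k%:R))).
    by apply: bigcupT_measurable => k; apply: sub_sigma_algebra; do 2 eexists.
  apply/seteqP; split=> x /=; rewrite in_itv/=.
    move=> xi; have [k _ /cubeP xk] : (\bigcup_k cube k%:R) (x : 'rV[R]_N).
      by rewrite cube_cover.
    exists k => // j; rewrite !mxE; case: eqVneq => [->//|_].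
    by rewrite -real_ltr_norml ?num_real.
  by move=> [k _ /(_ i)]; rewrite !mxE eqxx.
by have := mi measurableT Y mY; rewrite setTI.
Qed.

Lemma lebesgue_row_boxE a b :
  leb (box a b) = (\prod_(i < N) Num.max 0 (b ord0 i - a ord0 i))%:E.
Proof.
rewrite (_ : box a b = [set x | forall i, `]a ord0 i, b ord0 i[%classic (x ord0 i)]).
  rewrite (@lebesgue_row_box _ _ (fun i => `]a ord0 i, b ord0 i[%classic)); last first.
    by move=> i; exact: measurable_itv.
  rewrite (eq_bigr (fun i => (Num.max 0 (b ord0 i - a ord0 i))%:E)).
    by elim/big_ind2 : _ => // x r y s -> ->.
  move=> i _; rewrite lebesgue_measure_itv/= lte_fin; case: ifPn => ab.
    by rewrite -EFinB max_r// subr_ge0 ltW.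
  by rewrite max_l// subr_le0 leNgt.
by apply/seteqP; split=> x H i; have := H i; rewrite /= in_itv.
Qed.

Lemma lebesgue_row_box_lty a b : (leb (box a b) < +oo)%E.
Proof. by rewrite lebesgue_row_boxE ltry. Qed.

Lemma measurable_row_add d (T : measurableType d) (f g : T -> 'rV[R]_N) :
  measurable_fun setT f -> measurable_fun setT g ->
  measurable_fun setT (fun t : T => f t + g t).
Proof.
move=> /measurable_fun_rowP mf /measurable_fun_rowP mg.
apply/measurable_fun_rowP => i; under eq_fun do rewrite mxE.
exact: measurable_funD.
Qed.

Lemma measurable_shift h : measurable_fun setT (fun x : 'rV[R]_N => x + h).
Proof. exact: measurable_row_add. Qed.

Lemma lebesgue_row_shift h (A : set 'rV[R]_N) : measurable A ->
  pushforward leb (fun x : 'rV[R]_N => x + h) A = leb A.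
Proof.
pose nu := measure_function_pushforward__canonical__measure_function_Measure
  leb (measurable_shift h).
move=> mA; have cubes k : boxes (cube k%:R).
  by exists (const_mx (- k%:R)), (const_mx k%:R).
have E a b : nu (box a b) = leb (box a b).
  rewrite /nu/= /pushforward (_ : _ @^-1` _ = box (a - h) (b - h)).
    by rewrite !lebesgue_row_boxE; congr EFin; apply: eq_bigr => i _;
      rewrite !mxE opprB addrA subrK.
  by apply/seteqP; split=> x H i; have := H i; rewrite !mxE ltrBlDr ltrBrDr.
apply: (@measure_unique _ _ _ boxes (fun k => cube k%:R)
  measurable_rowE setI_closed_boxes cubes cube_cover nu leb) => //.
- by move=> _ [a [b ->]]; exact: E.
- by move=> k; rewrite E lebesgue_row_box_lty.
Qed.

Lemma ge0_integral_shift h (f : 'rV[R]_N -> \bar R) : measurable_fun setT f ->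
  (forall x, 0 <= f x)%E -> (\int[leb]_x f (x + h)%R = \int[leb]_x f x)%E.
Proof.
move=> mf f0; have := @ge0_integral_pushforward _ _ _ _ _ _
  (measurable_shift h) leb setT f measurableT mf (fun y _ => f0 y).
rewrite preimage_setT => <-; apply: eq_measure_integral => [|mh A mA _]; first exact: measurable_shift.
exact: lebesgue_row_shift.
Qed.

Lemma measurable_fun_shift d (T : measurableType d) h (f : 'rV[R]_N -> T) :
  measurable_fun setT f -> measurable_fun setT (fun x => f (x + h)).
Proof. by move=> mf; apply: (measurableT_comp mf); exact: measurable_shift. Qed.

Lemma integrable_shift h (f : 'rV[R]_N -> \bar R) : leb.-integrable setT f ->
  leb.-integrable setT (fun x => f (x + h)).
Proof.
move=> /integrableP[mf foo]; apply/integrableP; split.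
  exact: measurable_fun_shift.
rewrite (@ge0_integral_shift h (fun x => `|f x|%E))//.
exact: measurableT_comp.
Qed.

Lemma Rintegral_shift h (f : 'rV[R]_N -> R) :
  leb.-integrable setT (EFin \o f) ->
  \int[leb]_x f (x + h) = \int[leb]_x f x.
Proof.
move=> /[dup] If /integrableP[/measurable_EFinP mf _].
have mfp : measurable_fun setT ((EFin \o f)^\+)%E.
  by apply: measurable_funepos; exact/measurable_EFinP.
have mfn : measurable_fun setT ((EFin \o f)^\-)%E.
  by apply: measurable_funeneg; exact/measurable_EFinP.
rewrite /Rintegral integralE [in RHS]integralE; congr (fine (_ - _))%E.
  rewrite -(ge0_integral_shift h mfp (fun x => funepos_ge0 _ x)).
  by apply: eq_integral => x _; rewrite !(funeposE, funenegE).
rewrite -(ge0_integral_shift h mfn (fun x => funeneg_ge0 _ x)).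
by apply: eq_integral => x _; rewrite !(funeposE, funenegE).
Qed.

Local Notation L2 := (Lfun leb 2%:E).

Lemma Lfun2_shift h (f : 'rV[R]_N -> R) : f \in L2 -> (fun x => f (x + h)) \in L2.
Proof.
move=> /Lfun2P[mf If]; apply/Lfun2P; split; first exact: measurable_fun_shift.
exact: (integrable_shift h If).
Qed.

Lemma ip_shift h (f g : 'rV[R]_N -> R) : f \in L2 -> g \in L2 ->
  inner leb (fun x => f (x + h)) (fun x => g (x + h)) = inner leb f g.
Proof.
move=> Lf Lg; exact: (Rintegral_shift h (Lfun2_mul Lf Lg)).
Qed.

Lemma n2_shift h (f : 'rV[R]_N -> R) : f \in L2 ->
  norm2 leb (fun x => f (x + h)) = norm2 leb f.
Proof. by move=> Lf; rewrite /norm2 ip_shift. Qed.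

End boxes.

(** * Explicit smooth functions *)

Section curve.
Context (R : realType) (V : normedModType R).

(** Both difference quotients are the same function. Directional derivatives thus become derivatives
    in one real variable, open to the one-variable chain rule and to differentiation under the
    integral. *)
Lemma is_derive_line (f : V -> R) (x e : V) (t df : R) :
  is_derive (x + t *: e) e f df <-> is_derive t 1 (fun s : R => f (x + s *: e)) df.
Proof.
have E : (fun h : R => h^-1 *: ((f \o shift (x + t *: e)) (h *: e) - f (x + t *: e)))
   = (fun h : R => h^-1 *: (((fun s : R => f (x + s *: e)) \o shift t) (h *: 1)
       - f (x + t *: e))).
  apply/funext => h /=; congr (_ *: (f _ - _)).
  by rewrite /= [h *: 1]mulr1 scalerDl addrCA addrA.
have D : derivable f (x + t *: e) e = derivable (fun s : R => f (x + s *: e)) t 1.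
  by rewrite /derivable E.
have D' : 'D_e f (x + t *: e) = 'D_1 (fun s : R => f (x + s *: e)) t.
  by rewrite /derive E.
split=> -[ex <-]; split; [by rewrite -D|by rewrite -D'|by rewrite D|by rewrite D'].
Qed.

End curve.

Section bump.
Context (R : realType).
Implicit Types (P : {poly R}) (y : R).

(** Multiples of the flat function exp(-1/y) by polynomials in 1/y, extended by 0. The family is
    closed under derivation, so one first-order computation yields smoothness. *)
Definition expinv P y : R := if 0 < y then P.[y^-1] * expR (- y^-1) else 0.

(** Monomial by monomial: z^i is at most i! exp z, by the exponential series. *)
Lemma horner_expRN_bounded P : exists C : R, forall z, 0 <= z ->
  `|P.[z] * expR (- z)| <= C.
Proof.
exists (\sum_(i < size P) `|P`_i| * i`!%:R) => z z0.
rewrite normrM (ger0_norm (expR_ge0 _)) horner_coef.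
rewrite (le_trans (ler_wpM2r (expR_ge0 _) (ler_norm_sum _ _ _)))//.
rewrite mulr_suml ler_sum// => i _; rewrite normrM -mulrA ler_wpM2l//.
rewrite normrX ger0_norm// expRN ler_pdivrMr ?expR_gt0//.
case: (nat_of_ord i) => [|k].
  rewrite fact0 mul1r expr0.
  by rewrite (le_trans _ (expR_ge1Dx z))// lerDl.
have := expR_ge1Dxn k z0; rewrite -ler_pdivrMl ?ltr0n ?fact_gt0//.
by move/(le_trans _); apply; rewrite mulrC lerDr.
Qed.

(** The previous bound applied to X^2 P rather than P. The gain of y^2 makes the difference quotient
    at 0 tend to 0. *)
Lemma expinv_bound P : exists C : R, forall y, `|expinv P y| <= C * y ^+ 2.
Proof.
have [C HC] := horner_expRN_bounded ('X^2 * P).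
have C0 : 0 <= C by rewrite (le_trans _ (HC 0 _))//.
exists C => y; rewrite /expinv; case: ifPn => y0; last first.
  by rewrite normr0 mulr_ge0// sqr_ge0.
have yi : 0 <= y^-1 by rewrite invr_ge0 ltW.
have := HC _ yi; rewrite hornerM hornerXn -mulrA normrM.
rewrite (ger0_norm (exprn_ge0 _ yi)) exprVn.
by rewrite ler_pdivrMl ?exprn_gt0// [y ^+ 2 * C]mulrC.
Qed.

(* With y = 1/z, the derivative of P(1/z) exp(-1/z) is y^2 (P - P')(y) exp(-y). *)
Definition expinv_next P : {poly R} := 'X^2 * (P - P^`()).

Lemma is_derive_expinv P y : is_derive y 1 (expinv P) (expinv (expinv_next P) y).
Proof.
have [y0|y0|->] := ltgtP y 0.
- rewrite (_ : expinv (expinv_next P) y = 0); last first.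
    by rewrite /expinv ltNge (ltW y0).
  apply: (@near_eq_is_derive _ _ _ (cst 0)).
  near=> z; rewrite /expinv ifF//; apply/negbTE; rewrite -leNgt.
  by near: z; exact: lt_le_nbhsl.
- have yn0 : y != 0 by rewrite gt_eqF.
  rewrite (_ : expinv _ y = (expinv_next P).[y^-1] * expR (- y^-1)); last first.
    by rewrite /expinv y0.
  apply: (@near_eq_is_derive _ _ _ (fun z : R => P.[z^-1] * expR (- z^-1) : R)).
    near=> z; rewrite /expinv ifT//; near: z; exact: lt_nbhsr.
  have dV : is_derive y 1 (fun z : R => z^-1) (- y ^- 2).
    apply: DeriveDef; first exact: (@derivableV _ _ (fun z : R => z)).
    rewrite (@deriveV _ _ (fun z : R => z))// derive_id.
    exact: mulr1.
  have dP : is_derive y 1 (fun z : R => P.[z^-1] : R) (- y ^- 2 * P^`().[y^-1]).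
    have dP : is_derive y^-1 1 (horner P) P^`().[y^-1].
      have -> : P^`().[y^-1] = 'D_1 (horner P) y^-1 by rewrite derivE derive1E.
      by apply: derivableP; exact: derivable_horner.
    by rewrite mulrC; exact: (@is_derive1_comp _ (horner P) (fun z : R => z^-1) y).
  have dE : is_derive y 1 (fun z : R => expR (- z^-1)) (y ^- 2 * expR (- y^-1)).
    have dN := is_deriveN dV; rewrite opprK in dN.
    by rewrite mulrC; exact: (@is_derive1_comp _ expR (fun z : R => - z^-1) y).
  apply: (is_derive_eq (is_deriveM dP dE)).
  rewrite /expinv_next hornerM hornerXn hornerD hornerN /GRing.scale/=.
  by rewrite exprVn; ring.
- rewrite [X in is_derive _ _ _ X](_ : _ = 0); last by rewrite /expinv ltxx.
  have [C HC] := expinv_bound P.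
  suff H : h^-1 *: ((expinv P \o shift 0) (h *: 1) - expinv P 0) @[h --> 0^'] --> (0 : R).
    by apply: DeriveDef; [apply/cvg_ex; exists 0|exact: cvg_lim].
  have C0 : 0 < `|C| + 1 by rewrite ltr_wpDl.
  apply/cvgr0Pnorm_le => e e0; near=> h.
  have h0 : h != 0 by near: h; exact: nbhs_dnbhs_neq.
  rewrite /= addr0 [h *: 1]mulr1 {2}/expinv ltxx subr0 normrM normfV.
  rewrite ler_pdivrMl ?normr_gt0// (le_trans (HC _))//.
  rewrite -[h ^+ 2]real_normK ?num_real// expr2 mulrA mulrC ler_wpM2l//.
  apply: (@le_trans _ _ ((`|C| + 1) * `|h|)).
    by rewrite ler_wpM2r// (le_trans (ler_norm C))// lerDl.
  rewrite mulrC -ler_pdivlMr//; near: h.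
  apply: dnbhs0_le; exact: divr_gt0.
Unshelve. all: by end_near. Qed.

End bump.

Section bumpy.
Context (R : realType) (N : nat).
Implicit Types (f g : 'rV[R]_N -> R) (e x : 'rV[R]_N).

(* The explicit form makes smoothness provable: this algebra is stable under
   directional derivatives, and its compactly supported members are dense in L2. *)
Inductive bumpy : ('rV[R]_N -> R) -> Prop :=
| bumpy_cst c : bumpy (cst c)
| bumpyD f g : bumpy f -> bumpy g -> bumpy (f + g)
| bumpyM f g : bumpy f -> bumpy g -> bumpy (f * g)
| bumpy_expinv P a b j : bumpy (fun x => expinv P (a + b * x ord0 j)).

Lemma bumpy_differentiable f x : bumpy f -> differentiable f x.
Proof.
elim=> [c|{}f g _ ? _ ?|{}f g _ ? _ ?|P a b j].
- exact: differentiable_cst.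
- exact: differentiableD.
- exact: differentiableM.
apply: (@differentiable_comp _ _ _ _ (fun y : 'rV[R]_N => a + b * y ord0 j)).
  apply: differentiableD; first exact: differentiable_cst.
  apply: differentiableM; first exact: differentiable_cst.
  exact: differentiable_coord.
by apply/derivable1_diffP; case: (is_derive_expinv P (a + b * x ord0 j)).
Qed.

Lemma bumpy_derive f e : bumpy f -> exists2 g, bumpy g & (fun y => 'D_e f y) = g.
Proof.
elim=> [c|{}f g bf [f' bf' Ef] bg [g' bg' Eg]|{}f g bf [f' bf' Ef] bg [g' bg' Eg]|P a b j].
- exists (cst 0); first exact: bumpy_cst.
  by apply/funext => y; exact: derive_cst.
- exists (f' + g'); first exact: bumpyD.
  by apply/funext => y; rewrite deriveD -?Ef -?Eg//;
    apply/diff_derivable/bumpy_differentiable.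
- exists (f * g' + g * f'); first by apply: bumpyD; apply: bumpyM.
  by apply/funext => y; rewrite deriveM -?Ef -?Eg//;
    apply/diff_derivable/bumpy_differentiable.
exists (cst (b * e ord0 j) * (fun x => expinv (expinv_next P) (a + b * x ord0 j))).
  by apply: bumpyM; [exact: bumpy_cst|exact: bumpy_expinv].
apply/funext => y /=.
suff H : is_derive (y + 0 *: e) e (fun x => expinv P (a + b * x ord0 j))
   (b * e ord0 j * expinv (expinv_next P) (a + b * y ord0 j)).
  by rewrite scale0r addr0 in H; rewrite (@derive_val _ _ _ _ _ _ _ H).
apply/is_derive_line.
pose c := a + b * y ord0 j; pose k := b * e ord0 j.
have dA : is_derive (0 : R) 1 (fun s : R => c + k * s) k.
  have := is_deriveD (is_derive_cst c (0 : R) 1) (is_deriveZ k (is_derive_id (0 : R) 1)).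
  by rewrite add0r [k *: 1]mulr1.
have dP : is_derive (c + k * 0) 1 (expinv P) (expinv (expinv_next P) c).
  by rewrite mulr0 addr0; exact: is_derive_expinv.
have -> : (fun s : R => expinv P (a + b * (y + s *: e) ord0 j)) =
  expinv P \o (fun s : R => c + k * s).
  by apply/funext => s /=; rewrite !mxE /c /k; congr expinv; ring.
by rewrite mulrC; exact: (@is_derive1_comp _ _ (fun s : R => c + k * s) 0).
Qed.

Lemma bumpy_smooth f : bumpy f -> smooth f.
Proof.
move=> bf s x; suff : bumpy (foldr (fun e g y => 'D_e g y) f s).
  exact: bumpy_differentiable.
by elim: s => //= e s /(bumpy_derive e)[g bg ->].
Qed.

Lemma compact_support_cube f M : (forall x, f x != 0 -> cube M x) ->
  compact (closure [set x | f x != 0]).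
Proof.
move=> fM; have cK : compact [set x : 'rV[R]_N | forall i, `[(- M), M]%classic (x ord0 i)].
  by apply: (@rV_compact _ _ (fun=> `[(- M), M]%classic)) => i; exact: segment_compact.
apply: (subclosed_compact _ cK); first exact: closed_closure.
rewrite closureE; apply: smallest_sub.
  by apply: compact_closed => //; exact: norm_hausdorff.
move=> x /fM H i; have := H i.
by rewrite !mxE /= in_itv/= => /andP[/ltW -> /ltW ->].
Qed.

Lemma bumpy_test f M : bumpy f -> (forall x, f x != 0 -> cube M x) ->
  test_function f.
Proof. by move=> bf fM; split; [exact: bumpy_smooth|exact: compact_support_cube fM]. Qed.

End bumpy.

(** * Continuous functions with compact support: measurability and square integrability *)

Section continuous_row.
Context (R : realType) (N : nat).
Implicit Types (f : 'rV[R]_N -> R) (x h e : 'rV[R]_N).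
Local Notation leb := (@lebesgue_row R N).
Local Notation L2 := (Lfun leb 2%:E).

(* The Borel sets of the product topology are generated by countably many boxes:
   [f] is a limit of functions constant on the cells of a grid. *)
Lemma continuous_measurable_row f : continuous f -> measurable_fun setT f.
Proof.
move=> cf; pose r (n : nat) x : 'rV[R]_N :=
  \row_i ((Num.floor (n.+1%:R * x ord0 i))%:~R / n.+1%:R).
apply: (@measurable_fun_cvg _ _ _ _ (fun n => f \o r n)); last first.
  move=> x _; apply/cvgrPdist_lt => eps eps0.
  have /cvgrPdist_lt/(_ _ eps0) := cf x.
  rewrite near_simpl => /nbhs_ballP[d /= d0 dP].
  near=> n; apply: dP; split => // i j; rewrite (ord1 i) /ball/= !mxE.
  have n0 : 0 < n.+1%:R :> R by rewrite ltr0n.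
  apply: (@le_lt_trans _ _ n.+1%:R^-1).
    rewrite -{1}[x ord0 j](mulfK (lt0r_neq0 n0)) -mulrBl normrM [x _ _ * _]mulrC.
    rewrite [`|_^-1|]ger0_norm ?invr_ge0// -[leRHS]mul1r ler_wpM2r ?invr_ge0//.
    rewrite ger0_norm ?subr_ge0 ?ge_floor// lerBlDr addrC -intrD1 ltW//.
    exact: floorD1_gt.
  by near: n; exact: near_infty_natSinv_lt (PosNum d0).
move=> n _ Y mY; rewrite setTI.
pose F (z : 'rV[int]_N) : set 'rV[R]_N := [set x |
  [forall i, z ord0 i == Num.floor (n.+1%:R * x ord0 i)]].
have mF z : measurable (F z).
  rewrite (_ : F z = \bigcap_(i in [set: 'I_N]) ((fun x : 'rV[R]_N => x ord0 i) @^-1`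
      `[(z ord0 i)%:~R / n.+1%:R, ((z ord0 i + 1)%:~R / n.+1%:R)[)).
    apply: fin_bigcap_measurable => // i _.
    rewrite -[X in measurable X]setTI.
    exact: (measurable_row_coord i measurableT (measurable_itv _)).
  have n0 : 0 < n.+1%:R :> R by rewrite ltr0n.
  have E i x : (z ord0 i == Num.floor (n.+1%:R * x ord0 i)) =
      ((z ord0 i)%:~R / n.+1%:R <= x ord0 i < (z ord0 i + 1)%:~R / n.+1%:R).
    rewrite ler_pdivrMr// ltr_pdivlMr// mulrC.
    by rewrite -real_floor_eq ?num_real// eq_sym.
  apply/seteqP; split=> x /=.
    by move=> /forallP H i _ /=; rewrite in_itv/= -E.
  by move=> H; apply/forallP => i; have := H i I; rewrite /= in_itv/= -E.
pose g (z : 'rV[int]_N) : 'rV[R]_N := \row_i ((z ord0 i)%:~R / n.+1%:R).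
rewrite (_ : _ @^-1` Y = \bigcup_z (if f (g z) \in Y then F z else set0)).
  by apply: countable_bigcupT_measurable => // z; case: ifP.
apply/seteqP; split=> x /=.
  move=> Yx; exists (\row_i Num.floor (n.+1%:R * x ord0 i)) => //.
  rewrite ifT; first by apply/forallP => i; rewrite mxE.
  rewrite inE; congr Y : Yx; congr f; apply/rowP => i.
  by rewrite !mxE.
move=> [z _]; case: ifPn => // /set_mem Yz /forallP Fz.
congr Y : Yz; congr f; apply/rowP => i.
by rewrite !mxE (eqP (Fz i)).
Unshelve. all: by end_near. Qed.

Lemma compact_support_bounded f : continuous f ->
  compact (closure [set x | f x != 0]) ->
  exists M r : R, (forall x, `|f x| <= M) /\ (forall x, f x != 0 -> cube r x).
Proof.
move=> cf cK; set K := closure _ in cK.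
have cfK : compact (f @` K).
  by apply: continuous_compact => //; exact: continuous_subspaceT.
have [M [_ /(_ (M + 1)) HM]] := compact_bounded cfK.
have [r [_ /(_ (r + 1)) Hr]] := compact_bounded cK.
exists (Num.max 0 (M + 1)), (r + 2); split=> [x|x fx0].
  have [->|fx0] := eqVneq (f x) 0; first by rewrite normr0 le_max lexx.
  rewrite le_max HM ?orbT ?ltrDl//; exists x => //.
  exact: subset_closure.
apply/cubeP => i; rewrite (@le_lt_trans _ _ (r + 1))//.
  apply: le_trans (Hr _ x (subset_closure _)) => //; last by rewrite ltrDl.
  rewrite /Num.norm/= mx_normrE.
  by apply: le_trans (le_bigmax _ _ (ord0, i)) => /=.
by rewrite ltrD2l ltr1n.
Qed.

Lemma Lfun2_cube f M r : measurable_fun setT f -> (forall x, `|f x| <= M) ->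
  (forall x, f x != 0 -> cube r x) -> f \in L2.
Proof.
move=> mf fM fr.
have L1 : (\1_(cube r) : 'rV[R]_N -> R) \in L2.
  by apply: Lfun2_indic; [exact: measurable_box|exact: lebesgue_row_box_lty].
apply: (Lfun2_dominated mf (Lfun2Z M L1)) => x.
have [->|/fr/mem_set xr] := eqVneq (f x) 0; first by rewrite normr0.
by rewrite indicE xr mulr1 (le_trans (fM x))// ler_norm.
Qed.

Lemma test_continuous f : test_function f -> continuous f.
Proof. by move=> [sf _] x; exact: differentiable_continuous (sf [::] x). Qed.

Lemma test_differentiable f x : test_function f -> differentiable f x.
Proof. by move=> [sf _]; exact: (sf [::]). Qed.

Lemma test_Lfun2 f : test_function f -> f \in L2.
Proof.
move=> /[dup] /test_continuous cf [_ cK].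
have [M [r [fM fr]]] := compact_support_bounded cf cK.
exact: Lfun2_cube (continuous_measurable_row cf) fM fr.
Qed.

End continuous_row.

(** * Density of test functions *)

Import HBNNSimple.

Section density.
Context (R : realType) (N : nat).
Implicit Types (f g th : 'rV[R]_N -> R) (A B : set 'rV[R]_N).
Local Notation leb := (@lebesgue_row R N).
Local Notation L2 := (Lfun leb 2%:E).
Local Notation n2 := (norm2 leb).

Definition bump_fun th := bumpy th /\ exists M, forall x, th x != 0 -> cube M x.

Lemma bump_test th : bump_fun th -> test_function th.
Proof. by move=> [bth [M thM]]; exact: bumpy_test bth thM. Qed.

Lemma bumpD th th' : bump_fun th -> bump_fun th' -> bump_fun (th + th').
Proof.
move=> [bth [M thM]] [bth' [M' thM']]; split; first exact: bumpyD.
exists (Num.max M M') => x; rewrite -[(th + th') x]/(th x + th' x).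
have [->|/thM /cubeP H _] := eqVneq (th x) 0.
  rewrite add0r => /thM' /cubeP H.
  by apply/cubeP => i; rewrite lt_max H orbT.
by apply/cubeP => i; rewrite lt_max H.
Qed.

Lemma bumpZ c th : bump_fun th -> bump_fun (fun x => c * th x).
Proof.
move=> [bth [M thM]]; split; first exact: (bumpyM (bumpy_cst N c) bth).
by exists M => x; rewrite mulf_eq0 negb_or => /andP[_ /thM].
Qed.

(** The L2 closure of [bump_fun]. It is a vector space stable under dominated pointwise limits, and
    this is how it grows from boxes to all of L2. *)
Definition bump_limit f := f \in L2 /\
  forall e, 0 < e -> exists2 th, bump_fun th & n2 (fun x => f x - th x) <= e.

Lemma bump_limit_lim f : f \in L2 ->
  (forall e, 0 < e -> exists2 g, bump_limit g & n2 (fun x => f x - g x) <= e) ->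
  bump_limit f.
Proof.
move=> Lf H; split=> // e e0; have e20 : 0 < e / 2 by rewrite divr_gt0.
have [g [Lg /(_ _ e20)[th bth gth]] fg] := H _ e20; exists th => //.
have Lth := test_Lfun2 (bump_test bth).
rewrite (_ : (fun _ => _) = (fun x => (f x - g x) + (g x - th x))); last first.
  by apply/funext => x; rewrite addrA subrK.
apply: le_trans (n2D (Lfun2B Lf Lg) (Lfun2B Lg Lth)) _.
by rewrite (splitr e) lerD.
Qed.

Lemma bump_limit_dominated (f_ : nat -> 'rV[R]_N -> R) f g :
  (forall n, bump_limit (f_ n)) -> g \in L2 -> (forall n x, `|f_ n x| <= `|g x|) ->
  (forall x, f_ ^~ x @ \oo --> f x) -> bump_limit f.
Proof.
move=> Lf_ Lg f_g f_f.
have [Lf H] := n2_dominated_cvg (fun n => (Lf_ n).1) Lg f_g f_f.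
by apply: bump_limit_lim => // e /H[n Hn]; exists (f_ n).
Qed.

Lemma bump_limitD f g : bump_limit f -> bump_limit g ->
  bump_limit (fun x => f x + g x).
Proof.
move=> [Lf fH] [Lg gH]; split; first exact: Lfun2D.
move=> e e0; have e20 : 0 < e / 2 by rewrite divr_gt0.
have [th bth fth] := fH _ e20; have [th' bth' gth'] := gH _ e20.
exists (th + th'); first exact: bumpD.
have Lth := test_Lfun2 (bump_test bth).
have Lth' := test_Lfun2 (bump_test bth').
rewrite (_ : (fun _ => _) = (fun x => (f x - th x) + (g x - th' x))); last first.
  by apply/funext => x; rewrite -[(th + th') x]/(th x + th' x); ring.
apply: le_trans (n2D (Lfun2B Lf Lth) (Lfun2B Lg Lth')) _.
by rewrite (splitr e) lerD.
Qed.

Lemma bump_limitZ c f : bump_limit f -> bump_limit (fun x => c * f x).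
Proof.
move=> [Lf fH]; split; first exact: Lfun2Z.
move=> e e0; have c0 : 0 < `|c| + 1 by rewrite ltr_wpDl.
have [th bth fth] := fH _ (divr_gt0 e0 c0).
have Lth := test_Lfun2 (bump_test bth).
exists (fun x => c * th x); first exact: bumpZ.
rewrite (_ : (fun _ => _) = (fun x => c * (f x - th x))); last first.
  by apply/funext => x; rewrite mulrBr.
rewrite (n2Z _ (Lfun2B Lf Lth)).
rewrite (le_trans (ler_wpM2l (normr_ge0 _) fth))// mulrA ler_pdivrMr//.
by rewrite [_ * e]mulrC ler_wpM2l ?(ltW e0)// lerDl.
Qed.

Lemma bump_limitB f g : bump_limit f -> bump_limit g ->
  bump_limit (fun x => f x - g x).
Proof.
move=> bf bg; rewrite (_ : (fun _ => _) = (fun x => f x + -1 * g x)).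
  by apply: bump_limitD => //; exact: bump_limitZ.
by apply/funext => x; rewrite mulN1r.
Qed.

(** Equal to exp(-1/((n+1) z)) for z > 0 and to 0 otherwise: values in [0, 1], and limit 1 exactly
    on z > 0, so that products tend to the indicator of an open box. *)
Definition step_bump (z : R) (n : nat) : R := expinv 1 (n.+1%:R * z).

Lemma step_bump_itv z n : 0 <= step_bump z n <= 1.
Proof.
rewrite /step_bump /expinv; case: ifPn => z0; last by rewrite lexx ler01.
by rewrite hornerE mul1r expR_ge0 expR_le1 oppr_le0 invr_ge0 ltW.
Qed.

Lemma step_bump_neq0 z n : step_bump z n != 0 -> 0 < z.
Proof.
by rewrite /step_bump /expinv; case: ifPn => [|]; rewrite ?eqxx// pmulr_rgt0.
Qed.

Lemma step_bump_cvg z : 0 < z -> step_bump z n @[n --> \oo] --> (1 : R).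
Proof.
move=> z0; rewrite -expR0 -oppr0.
rewrite (_ : (fun n => _) = (fun n => expR (- (n.+1%:R^-1 * z^-1)))); last first.
  apply/funext => n; rewrite /step_bump /expinv pmulr_rgt0// z0 hornerE mul1r.
  by rewrite invfM.
apply: continuous_cvg; first exact: continuous_expR.
apply: cvgN; rewrite -(mul0r z^-1); apply: cvgMl; exact: cvg_harmonic.
Qed.

Lemma bumpy_prod (I : Type) (s : seq I) (F : I -> 'rV[R]_N -> R) :
  (forall i, bumpy (F i)) -> bumpy (fun x => \prod_(i <- s) F i x).
Proof.
move=> bF; elim: s => [|i s IH].
  rewrite (_ : (fun _ => _) = cst 1); first exact: bumpy_cst.
  by apply/funext => x; rewrite big_nil.
rewrite (_ : (fun _ => _) = F i * (fun x => \prod_(j <- s) F j x)).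
  exact: bumpyM.
by apply/funext => x; rewrite big_cons.
Qed.

Definition box_bump (a b : 'rV[R]_N) n (x : 'rV[R]_N) : R := \prod_(i < N)
  (step_bump (x ord0 i - a ord0 i) n * step_bump (b ord0 i - x ord0 i) n).

Lemma bump_box_bump a b n : bump_fun (box_bump a b n).
Proof.
split.
  apply: bumpy_prod => i.
  have -> : (fun x : 'rV[R]_N => step_bump (x ord0 i - a ord0 i) n *
      step_bump (b ord0 i - x ord0 i) n) =
    (fun x : 'rV[R]_N => expinv 1 (- n.+1%:R * a ord0 i + n.+1%:R * x ord0 i)) *
    (fun x => expinv 1 (n.+1%:R * b ord0 i + - n.+1%:R * x ord0 i)).
    apply/funext => x.
    transitivity (expinv 1 (- n.+1%:R * a ord0 i + n.+1%:R * x ord0 i) *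
        expinv 1 (n.+1%:R * b ord0 i + - n.+1%:R * x ord0 i)); last by [].
    by rewrite /step_bump; congr (expinv _ _ * expinv _ _); ring.
  by apply: bumpyM; exact: bumpy_expinv.
exists (\sum_(i < N) (`|a ord0 i| + `|b ord0 i|)) => x.
move=> /prodf_neq0 H; apply/cubeP => i.
have := H i isT; rewrite mulf_eq0 negb_or => /andP[/step_bump_neq0 ax /step_bump_neq0 xb].
apply: (@lt_le_trans _ _ (`|a ord0 i| + `|b ord0 i|)); last first.
  by rewrite (bigD1 i)//= lerDl sumr_ge0// => j _; rewrite addr_ge0.
rewrite ltr_norml.
have := ler_norm (b ord0 i); have := ler_norm (- a ord0 i); rewrite normrN.
have := normr_ge0 (b ord0 i); have := normr_ge0 (a ord0 i).
by move=> *; apply/andP; split; lra.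
Qed.

Lemma box_bump_itv a b n x : 0 <= box_bump a b n x <= 1.
Proof.
have H i : 0 <= step_bump (x ord0 i - a ord0 i) n * step_bump (b ord0 i - x ord0 i) n <= 1.
  have /andP[p0 p1] := step_bump_itv (x ord0 i - a ord0 i) n.
  have /andP[q0 q1] := step_bump_itv (b ord0 i - x ord0 i) n.
  by rewrite mulr_ge0// mulr_ile1.
apply/andP; split; first by apply: prodr_ge0 => i _; case/andP: (H i).
exact: prodr_ile1.
Qed.

Lemma box_bump_box a b n x : box_bump a b n x != 0 -> box a b x.
Proof.
move=> /prodf_neq0 H i; have := H i isT.
rewrite mulf_eq0 negb_or => /andP[/step_bump_neq0 ? /step_bump_neq0 ?].
by apply/andP; split; rewrite -subr_gt0.
Qed.

Lemma bump_limit_box a b : bump_limit (\1_(box a b)).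
Proof.
have L1 : (\1_(box a b) : 'rV[R]_N -> R) \in L2.
  by apply: Lfun2_indic; [exact: measurable_box|exact: lebesgue_row_box_lty].
apply: (@bump_limit_dominated (box_bump a b) _ (\1_(box a b))) => //.
- move=> n; have bb := bump_box_bump a b n.
  split; first exact: test_Lfun2 (bump_test bb).
  move=> e e0; exists (box_bump a b n) => //.
  rewrite /norm2 /inner /Rintegral (_ : (fun x => _) = cst 0%E).
    by rewrite integral0 sqrtr0 ltW.
  by apply/funext => x /=; rewrite subrr mul0r.
- move=> n x; have /andP[p0 p1] := box_bump_itv a b n x.
  have [->|/box_bump_box/mem_set xb] := eqVneq (box_bump a b n x) 0.
    by rewrite normr0.
  by rewrite indicE xb normr1 ger0_norm.
- move=> x; rewrite indicE; have [/set_mem xb|xb] := boolP (x \in box a b); last first.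
    rewrite (_ : (fun n => _) = cst 0); first exact: cvg_cst.
    apply/funext => n; apply/eqP; apply: contraNT xb => /box_bump_box.
    exact: mem_set.
  (* The limit 1 is rewritten as a product of ones over the same list, and the limit is taken factor
     by factor. *)
  rewrite -[1%:R](@big1_eq _ _ *%R _ (index_enum 'I_N) xpredT).
  rewrite /box_bump.
  elim: (index_enum 'I_N) => [|i s IH].
    under eq_fun do rewrite big_nil.
    by rewrite big_nil; exact: cvg_cst.
  under eq_fun do rewrite big_cons.
  rewrite big_cons; apply: cvgM => //; rewrite -[1]mulr1.
  have /andP[ax bx] := xb i.
  by apply: cvgM; apply: step_bump_cvg; rewrite subr_gt0.
Qed.

(** The cube keeps every indicator in L2. The sets A with this property form a lambda-system,
    through linearity for differences and domination for increasing unions, and it contains the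
    boxes. *)
Lemma bump_limit_indic (A : set 'rV[R]_N) k : measurable A ->
  bump_limit (\1_(A `&` cube k%:R)).
Proof.
rewrite measurable_rowE; pose Q : set 'rV[R]_N := cube k%:R.
have mQ : measurable Q by exact: measurable_box.
have LQ : (\1_Q : 'rV[R]_N -> R) \in L2.
  by apply: Lfun2_indic => //; exact: lebesgue_row_box_lty.
pose H := [set A : set 'rV[R]_N | bump_limit (\1_(A `&` Q))].
suff : <<s @boxes R N >> `<=` H by move=> sH /sH.
apply: lambda_system_subset => //; first exact: setI_closed_boxes; last first.
  move=> B Bb; have : @boxes R N (B `&` Q).
    apply: setI_closed_boxes => //.
    by exists (const_mx (- k%:R)), (const_mx k%:R).
  by move=> [a [b E]]; rewrite /H/= E; exact: bump_limit_box.
split=> //.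
- by rewrite /H/= setTI; exact: bump_limit_box.
- move=> B C CB HB HC; rewrite /H/=.
  rewrite (_ : \1_(_) = (fun x => \1_(B `&` Q) x - \1_(C `&` Q) x)).
    exact: bump_limitB.
  apply/funext => x; rewrite setDE !indicE !in_setI in_setC.
  have : (x \in C) ==> (x \in B) by apply/implyP; rewrite !inE; exact: CB.
  by case: (x \in Q); case: (x \in B); case: (x \in C); rewrite ?subrr ?subr0.
move=> F ndF HF; rewrite /H/=.
apply: (@bump_limit_dominated (fun n => \1_(F n `&` Q)) _ (\1_Q)) => //.
  move=> n x; rewrite !indicE in_setI; case: (x \in Q); rewrite ?andbF//.
  by rewrite andbT normr1; case: (x \in F n); rewrite ?normr1 ?normr0.
move=> x; have [xF|xF] := pselect (exists i, F i x); last first.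
  rewrite (_ : \1_(_) x = 0); last first.
    rewrite indicE memNset// => -[[i _ Fix] _]; apply: xF; by exists i.
  rewrite (_ : (fun n => _) = cst 0); first exact: cvg_cst.
  apply/funext => n; rewrite indicE memNset// => -[Fnx _].
  by apply: xF; exists n.
have [i Fix] := xF.
have E n : (i <= n)%N -> \1_(F n `&` Q) x = \1_(\bigcup_i F i `&` Q) x :> R.
  move=> lein; rewrite !indicE !in_setI (mem_set (_ : (F n) x)).
    by rewrite (mem_set (_ : (\bigcup_i F i) x))//; exists i.
  by move: Fix; exact/subsetPset/ndF.
apply: cvg_near_cst; exists i => //= n lein; exact: E.
Qed.

Lemma bump_limit_sum (I : Type) (s : seq I) (F : I -> 'rV[R]_N -> R) :
  (forall i, bump_limit (F i)) -> bump_limit (fun x => \sum_(i <- s) F i x).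
Proof.
move=> bF; elim: s => [|i s IH].
  rewrite (_ : (fun _ => _) = (fun x => 0 * \1_(box 0 0) x)).
    by apply: bump_limitZ; exact: bump_limit_box.
  by apply/funext => x; rewrite big_nil mul0r.
rewrite (_ : (fun _ => _) = (fun x => F i x + \sum_(j <- s) F j x)).
  exact: bump_limitD.
by apply/funext => x; rewrite big_cons.
Qed.

Lemma bump_limit_ge0 f : f \in L2 -> (forall x, 0 <= f x) -> bump_limit f.
Proof.
move=> Lf f0; have mf : measurable_fun setT (EFin \o f).
  by apply/measurable_EFinP; exact: Lfun2_measurable Lf.
pose h := nnsfun_approx measurableT mf.
have h_cvg x : h n x @[n --> \oo] --> f x.
  exact: (fine_cvg (@cvg_nnsfun_approx _ _ _ setT measurableT _ mf
    (fun x _ => f0 x) x I)).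
have h_le n x : h n x <= f x.
  have <- := cvg_lim (@Rhausdorff R) (h_cvg x).
  apply: (@nondecreasing_cvgn_le _ (fun n => h n x)); last exact: cvgP (h_cvg x).
  by move=> p q pq; have /lefP := nd_nnsfun_approx measurableT mf pq; exact.
(* Simple functions increasing to f, cut by a cube that grows with n: each is a finite combination
   of indicators of bounded sets, and f dominates them all. *)
apply: (@bump_limit_dominated (fun n x => h n x * \1_(cube n%:R) x) _ f) => //.
- move=> n; pose s : seq R := finmap.enum_fset (fset_set (range (h n))).
  rewrite (_ : (fun _ => _) = (fun x =>
      \sum_(r <- s) r * \1_(h n @^-1` [set r] `&` cube n%:R) x)).
    apply: bump_limit_sum => r; apply: bump_limitZ; apply: bump_limit_indic.
    exact: measurable_funPTI.
  apply/funext => x; rewrite [h n x]fimfunE fsbig_finite//= mulr_suml.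
  by apply: eq_bigr => r _; rewrite indicI mulrA.
- move=> n x; rewrite normrM indicE ger0_norm// (ger0_norm (f0 x)).
  case: (_ \in _); rewrite ?normr1 ?normr0 ?mulr1 ?mulr0//.
- move=> x; rewrite -[f x]mulr1; apply: cvgM => //.
  have [k _ Qx] : (\bigcup_k cube k%:R) x by rewrite cube_cover.
  apply: cvg_near_cst; exists k => //= n kn.
  rewrite indicE mem_set//; apply/cubeP => i.
  by move/cubeP/(_ i)/lt_le_trans : Qx; apply; rewrite ler_nat.
Qed.

Lemma Lfun2_bump_limit f : f \in L2 -> bump_limit f.
Proof.
move=> Lf; have mf := Lfun2_measurable Lf.
rewrite (_ : f = (fun x => Num.max (f x) 0 - Num.max (- f x) 0)).
  apply: bump_limitB; apply: bump_limit_ge0.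
  - apply: (@Lfun2_dominated _ _ _ _ _ f) => //; first exact: measurable_maxr.
    by move=> x; have [] := leP (f x) 0; rewrite ?normr0.
  - by move=> x; rewrite le_max lexx orbT.
  - apply: (@Lfun2_dominated _ _ _ _ _ f) => //.
      by apply: measurable_maxr => //; exact: measurableT_comp.
    by move=> x; have [] := leP (- f x) 0; rewrite ?normr0 ?normrN.
  - by move=> x; rewrite le_max lexx orbT.
apply/funext => x; case: (leP (f x) 0) => fx; case: (leP (- f x) 0); lra.
Qed.

Lemma bump_dense f e : f \in L2 -> 0 < e ->
  exists2 th, bump_fun th & n2 (fun x => f x - th x) <= e.
Proof. by move=> /Lfun2_bump_limit[_]; exact. Qed.

End density.

(** * Difference quotients and weak derivatives *)

Section difference_quotients.
Context (R : realType) (N : nat).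
Implicit Types (f u v phi th : 'rV[R]_N -> R) (x e h : 'rV[R]_N).
Local Notation leb := (@lebesgue_row R N).
Local Notation L2 := (Lfun leb 2%:E).
Local Notation n2 := (norm2 leb).
Local Notation ip := (inner leb).

Lemma derive_shift_row f h e x :
  'D_e (fun y => f (y + h)) x = 'D_e f (x + h).
Proof.
have E : (fun s : R => s^-1 *: (((fun y => f (y + h)) \o shift x) (s *: e) - f (x + h))) =
    (fun s : R => s^-1 *: ((f \o shift (x + h)) (s *: e) - f (x + h))).
  by apply/funext => s /=; rewrite addrA.
by rewrite /derive E.
Qed.

Lemma test_shift phi h : test_function phi ->
  test_function (fun x => phi (x + h)).
Proof.
move=> /[dup] tphi [sphi cphi]; split.
  have E s : foldr (fun e g y => 'D_e g y) (fun x => phi (x + h)) s =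
      (fun x => foldr (fun e g y => 'D_e g y) phi s (x + h)).
    elim: s => //= e s ->; apply/funext => x; exact: derive_shift_row.
  move=> s x; rewrite E; apply: (@differentiable_comp _ _ _ _ (fun x => x + h)).
    have : differentiable ((id : 'rV[R]_N -> 'rV[R]_N) + cst h) x.
      by apply: differentiableD => //; exact: differentiable_cst.
    by [].
  exact: sphi.
have [M [r [_ Hr]]] := compact_support_bounded (test_continuous tphi) cphi.
apply: (@compact_support_cube _ _ _ (r + \sum_(i < N) `|h ord0 i|)) => x /Hr /cubeP H.
apply/cubeP => i; have := H i; rewrite mxE => Hi.
have : `|h ord0 i| <= \sum_(j < N) `|h ord0 j|.
  by rewrite (bigD1 i)//= lerDl sumr_ge0.
have := ler_normB (x ord0 i + h ord0 i) (h ord0 i); rewrite addrK; lra.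
Qed.

Lemma test_derive phi e : test_function phi -> test_function (fun x => 'D_e phi x).
Proof.
move=> /[dup] tphi [sphi cphi]; split.
  (* [foldr] differentiates first along the last entry, so the iterated derivatives of ['D_e phi]
     are those of phi along lists ending in e. *)
  by move=> s x; have := sphi (rcons s e) x; rewrite -cats1 foldr_cat.
apply: (subclosed_compact _ cphi); first exact: closed_closure.
rewrite [X in X `<=` _]closureE; apply: smallest_sub; first exact: closed_closure.
move=> x /=; apply: contra_neqP => xK.
have : \forall y \near x, cst 0 y = phi y.
  have : \forall y \near x, (~` closure [set x | phi x != 0]) y.
    apply: open_nbhs_nbhs; split => //; apply: closed_openC; exact: closed_closure.
  apply: filterS => y /= yK; apply/esym/eqP; apply: contra_notT yK.
  by move=> H; exact: (@subset_closure _ [set x | phi x != 0]) H.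
move=> /near_eq_derive <-; exact: derive_cst.
Qed.

Lemma integrable_cube_mul u M r : u \in L2 ->
  leb.-integrable setT (EFin \o (fun x => `|u x| * (M * \1_(cube r) x))).
Proof.
move=> Lu; apply: Lfun2_mul; last first.
  by apply: Lfun2Z; apply: Lfun2_indic; [exact: measurable_box|exact: lebesgue_row_box_lty].
apply: (Lfun2_dominated _ Lu); last by move=> x; rewrite normr_id.
by apply: measurableT_comp => //; exact: (Lfun2_measurable Lu).
Qed.

(** The shift acts on the smooth factor, so u needs no regularity beyond L2. *)
Lemma is_derive_ip_shift u phi e (t : R) : u \in L2 -> test_function phi ->
  is_derive t 1 (fun s : R => ip u (fun x => phi (x + s *: e)))
    (ip u (fun x => 'D_e phi (x + t *: e))).
Proof.
move=> Lu tphi; pose F (s : R) x := u x * phi (x + s *: e).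
have dF x (s : R) : is_derive s 1 (F ^~ x) (u x * 'D_e phi (x + s *: e)).
  have : is_derive (x + s *: e) e phi ('D_e phi (x + s *: e)).
    by apply/derivableP/diff_derivable/test_differentiable.
  by move=> /is_derive_line d; exact: (is_deriveZ (u x) d).
have tD := test_derive e tphi.
have [M [r [DM Dr]]] := compact_support_bounded (test_continuous tD) tD.2.
(* For s within 1 of t, the coordinates of [s *: e] are at most [|t| + 1] times the sum of the
   |e_i|; all the integrands are supported in this one cube, which gives an integrable bound. *)
pose r' := r + (`|t| + 1) * \sum_(i < N) `|e ord0 i|.
have M0 : 0 <= M by rewrite (le_trans (normr_ge0 _) (DM 0)).
have It : `]t - 1, t + 1[%classic t by rewrite /= in_itv/=; apply/andP; split; lra.
have intF s : leb.-integrable setT (EFin \o F s).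
  by apply: Lfun2_mul => //; exact/test_Lfun2/test_shift.
have derF (s : R) x : `]t - 1, t + 1[%classic s -> setT x -> derivable (F ^~ x) s 1.
  by move=> _ _; case: (dF x s).
have G0 x : 0 <= `|u x| * (M * \1_(cube r') x) by rewrite !mulr_ge0.
have ubF (s : R) x : `]t - 1, t + 1[%classic s -> setT x ->
    `|partial1of2 F s x| <= `|u x| * (M * \1_(cube r') x).
  rewrite /= in_itv/= => /andP[ts st] _; rewrite partial1of2E (@derive_val _ _ _ _ _ _ _ (dF x s)).
  rewrite normrM ler_wpM2l//.
  have [->|/Dr /cubeP Dx] := eqVneq ('D_e phi (x + s *: e)) 0.
    by rewrite normr0 mulr_ge0.
  rewrite indicE mem_set ?mulr1//; apply/cubeP => i.
  have := Dx i; rewrite !mxE => Dxi.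
  have eS : `|e ord0 i| <= \sum_(j < N) `|e ord0 j|.
    by rewrite (bigD1 i)//= lerDl sumr_ge0.
  have sT : `|s| <= `|t| + 1.
    rewrite -[s](subrK t) addrC (le_trans (ler_normD _ _))// lerD2l.
    by rewrite ler_norml; apply/andP; split; lra.
  have : `|s * e ord0 i| <= (`|t| + 1) * \sum_(j < N) `|e ord0 j|.
    by rewrite normrM ler_pM.
  have := ler_normB (x ord0 i + s * e ord0 i) (s * e ord0 i).
  by rewrite addrK /r'; lra.
have := @derivable_under_integral _ _ _ leb F setT measurableT t _ _ It
  (fun s _ => intF s) derF _ G0 (integrable_cube_mul M r' Lu) ubF.
have := @differentiation_under_integral _ _ _ leb F setT measurableT t _ _ It
  (fun s _ => intF s) derF _ G0 (integrable_cube_mul M r' Lu) ubF.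
rewrite derive1E => E d; apply: DeriveDef => //; rewrite E.
apply: eq_Rintegral => x _.
by rewrite partial1of2E (@derive_val _ _ _ _ _ _ _ (dF x t)).
Qed.

End difference_quotients.

(** * Weak derivatives against L2 norms of translation differences *)

Section weak_derivatives.
Context (R : realType) (N : nat).
Implicit Types (f u v phi th : 'rV[R]_N -> R) (x e h : 'rV[R]_N).
Local Notation leb := (@lebesgue_row R N).
Local Notation L2 := (Lfun leb 2%:E).
Local Notation n2 := (norm2 leb).
Local Notation ip := (inner leb).

Lemma n2_le_dual f (C : R) : 0 <= C -> f \in L2 ->
  (forall th, bump_fun th -> `|ip f th| <= C * n2 th) -> n2 f <= C.
Proof.
move=> C0 Lf H; rewrite leNgt; apply/negP => Cf.
have aC : 0 < n2 f + C by rewrite ltr_pwDl// (le_lt_trans C0).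
(* If th is within d of f, then |f|^2 = (f, f - th) + (f, th) is at most |f| d + C (|f| + d), that
   is |f| (|f| - C) <= d (|f| + C). The chosen d makes the right side half of the left one. *)
have d0 : 0 < (n2 f - C) * n2 f / (2 * (n2 f + C)).
  by rewrite divr_gt0 ?mulr_gt0 ?subr_gt0// (le_lt_trans C0).
have [th bth fth] := bump_dense Lf d0.
have Lth := test_Lfun2 (bump_test bth).
have Lfth := Lfun2B Lf Lth.
have E1 : n2 f ^+ 2 = ip f (fun x => f x - th x) + ip f th.
  by rewrite ipBr// n2_sqr subrK.
have E2 := le_trans (ler_norm _) (cauchy_schwarz Lf Lfth).
have E3 := le_trans (ler_norm _) (H _ bth).
have E4 : n2 th <= n2 f + n2 (fun x => f x - th x).
  apply: le_trans (n2B Lf Lfth); rewrite le_eqVlt; apply/orP; left; apply/eqP.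
  by congr norm2; apply/funext => x; rewrite subKr.
set d := n2 (fun x => f x - th x) in fth E1 E2 E3 E4.
have dE : d * (n2 f + C) <= (n2 f - C) * n2 f / 2.
  have := ler_wpM2r (ltW aC) fth; move/le_trans; apply.
  by rewrite le_eqVlt; apply/orP; left; apply/eqP; field; rewrite gt_eqF.
have := ler_wpM2l C0 E4.
have : 0 < (n2 f - C) * n2 f by rewrite mulr_gt0 ?subr_gt0// (le_lt_trans C0).
move: E1; rewrite expr2; nra.
Qed.

(** [weak_partial] treats coordinate directions only; translations by an arbitrary vector of a cube
    need oblique ones. *)
Definition weak_dir e u v := forall phi, test_function phi ->
  ip u (fun x => 'D_e phi x) = - ip v phi.

Lemma weak_dir_row (h : 'rV[R]_N) u (v : 'I_N -> 'rV[R]_N -> R) : u \in L2 ->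
  (forall i, v i \in L2) -> (forall i, weak_partial i u (v i)) ->
  weak_dir h u (fun x => \sum_(i < N) h ord0 i * v i x).
Proof.
move=> Lu Lv uv phi tphi.
have LD e := test_Lfun2 (test_derive e tphi).
have Lphi := test_Lfun2 tphi.
have -> : (fun x => 'D_h phi x) =
    (fun x => \sum_(i < N) h ord0 i * 'D_(delta_mx ord0 i) phi x).
  apply/funext => x; rewrite deriveE; last exact: test_differentiable.
  rewrite {1}[h]row_sum_delta linear_sum; apply: eq_bigr => i _.
  by rewrite linearZ deriveE//; exact: test_differentiable.
rewrite ipC !ip_suml//; [|by move=> i; exact: Lfun2Z|by move=> i; exact: Lfun2Z].
rewrite -sumrN; apply: eq_bigr => i _; rewrite !ipZl// -mulrN; congr (_ * _).
by rewrite ipC; exact: uv.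
Qed.

Lemma shiftB_ip u e phi : u \in L2 -> phi \in L2 ->
  ip (fun x => u (x + e)) phi = ip u (fun x => phi (x - e)).
Proof.
move=> Lu Lphi; have := ip_shift (- e) (Lfun2_shift e Lu) Lphi.
by under [X in inner _ X _ = _ -> _]eq_fun do rewrite subrK; move=> <-.
Qed.

(** By duality it suffices to test against th. The pairing of u with th(. - s e) has derivative (v,
    th(. - s e)) in s, of size at most |v| |th|, and the mean value theorem on [0, 1] concludes. *)
Lemma n2_shiftB_le u v e : u \in L2 -> v \in L2 -> weak_dir e u v ->
  n2 (fun x => u (x + e) - u x) <= n2 v.
Proof.
move=> Lu Lv uv; have Lue := Lfun2_shift e Lu.
apply: n2_le_dual => [||th /bump_test tth]; [exact: n2_ge0|exact: Lfun2B|].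
have Lth := test_Lfun2 tth.
pose m s := ip u (fun x => th (x + s *: - e)).
pose m' s := ip u (fun x => 'D_(- e) th (x + s *: - e)).
have dm (s : R) : is_derive s 1 m (m' s) by exact: is_derive_ip_shift.
have m'E s : `|m' s| <= n2 v * n2 th.
  have tths := test_shift (s *: - e) tth.
  have -> : m' s = ip v (fun x => th (x + s *: - e)).
    rewrite -[RHS]opprK -uv// -[RHS]mulN1r -ipZr//; last exact/test_Lfun2/test_derive.
    apply: eq_Rintegral => x _; congr (_ * _).
    rewrite derive_shift_row !deriveE; try exact: test_differentiable.
    by rewrite linearN mulN1r.
  by rewrite (le_trans (cauchy_schwarz Lv (test_Lfun2 tths)))// n2_shift.
have cm : {within `[0, 1], continuous m}.
  apply: continuous_subspaceT => s; apply: differentiable_continuous.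
  by apply/derivable1_diffP; case: (dm s).
have [c _ mc] := MVT_segment ler01 (fun s _ => dm s) cm.
rewrite ipBl// shiftB_ip// (_ : ip u th = m 0); last first.
  by congr inner; apply/funext => x; rewrite scale0r addr0.
rewrite (_ : ip u _ = m 1); last by congr inner; apply/funext => x; rewrite scale1r.
by rewrite mc subr0 mulr1.
Qed.

(** The quotient is moved onto phi, so no weak derivative of u has to exist. This makes it a tool
    for identifying one. *)
Lemma cvg_ip_quotient u e phi : u \in L2 -> test_function phi ->
  s^-1 * ip (fun x => u (x + s *: e) - u x) phi @[s --> 0^'] -->
    - ip u (fun x => 'D_e phi x).
Proof.
move=> Lu tphi; have Lphi := test_Lfun2 tphi.
have [dm Dm] := is_derive_ip_shift (- e) 0 Lu tphi.
have : 'D_1 (fun s : R => ip u (fun x => phi (x + s *: - e))) 0 =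
    - ip u (fun x => 'D_e phi x).
  rewrite Dm -[RHS]mulN1r -ipZr//; last exact/test_Lfun2/test_derive.
  apply: eq_Rintegral => x _; congr (_ * _).
  rewrite scale0r addr0 !deriveE; try exact: test_differentiable.
  by rewrite linearN mulN1r.
move=> <-; move: dm; rewrite /derivable /derive.
rewrite (_ : (fun h : R => h^-1 *: _) = (fun s : R =>
    s^-1 * ip (fun x => u (x + s *: e) - u x) phi))//.
apply/funext => s; rewrite ipBl//; last exact: Lfun2_shift.
rewrite shiftB_ip//.
transitivity (s^-1 * (ip u (fun x => phi (x + s *: - e)) -
    ip u (fun x => phi (x + 0 *: - e)))).
  by rewrite /= addr0 [s *: 1]mulr1.
have -> : (fun x => phi (x + 0 *: - e)) = phi.
  by apply/funext => x; rewrite scale0r addr0.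
by under [X in _ * (inner _ _ X - _) = _]eq_fun do rewrite scalerN.
Qed.

(* The weak derivative is a limit of difference quotients against test functions,
   so its norm is bounded by theirs. *)
Lemma n2_weak_dir_le u v e (C : R) : u \in L2 -> v \in L2 -> weak_dir e u v ->
  0 <= C -> (forall s : R, n2 (fun x => u (x + s *: e) - u x) <= `|s| * C) ->
  n2 v <= C.
Proof.
move=> Lu Lv uv C0 H; apply: n2_le_dual => // th /bump_test tth.
have Lth := test_Lfun2 tth.
have /cvg_norm := cvg_ip_quotient (e := e) Lu tth; rewrite uv// opprK => c.
rewrite -(cvg_lim _ c)//; apply: limr_le; first exact: cvgP c.
near=> s; have s0 : s != 0 by near: s; exact: nbhs_dnbhs_neq.
have Ls := Lfun2B (Lfun2_shift (s *: e) Lu) Lu.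
rewrite normrM normfV ler_pdivrMl ?normr_gt0// mulrA.
by rewrite (le_trans (cauchy_schwarz Ls Lth))// ler_wpM2r ?n2_ge0.
Unshelve. all: by end_near. Qed.

Lemma weak_dir_scale u v e (s : R) : u \in L2 -> v \in L2 -> weak_dir e u v ->
  weak_dir (s *: e) u (fun x => s * v x).
Proof.
move=> Lu Lv uv phi tphi; rewrite ipZl//; last exact: test_Lfun2.
rewrite -mulrN -uv// -ipZr//; last exact/test_Lfun2/test_derive.
apply: eq_Rintegral => x _; congr (_ * _).
by rewrite !deriveE; [rewrite linearZ|exact: test_differentiable..].
Qed.

Lemma n2_quotient_le u v e (s : R) : u \in L2 -> v \in L2 -> weak_dir e u v ->
  n2 (fun x => u (x + s *: e) - u x) <= `|s| * n2 v.
Proof.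
move=> Lu Lv uv; rewrite -n2Z//; apply: n2_shiftB_le => //; first exact: Lfun2Z.
exact: weak_dir_scale.
Qed.

(** Convergence against test functions extends to every f in L2, because the quotients are bounded
    in L2 by |v| and test functions are dense. *)
Lemma cvg_weak_quotient u v e f : u \in L2 -> v \in L2 -> f \in L2 ->
  weak_dir e u v ->
  s^-1 * ip (fun x => u (x + s *: e) - u x) f @[s --> 0^'] --> ip v f.
Proof.
move=> Lu Lv Lf uv; apply/cvgrPdist_le => eps eps0.
(* Budget: eps / 2 for the test function and eps / 4 for each of the two errors from replacing f by
   th; the + 1 covers |v| = 0. *)
have K0 : 0 < 2 * (n2 v + 1) by rewrite mulr_gt0// ltr_wpDl// n2_ge0.
have [th bth fth] := bump_dense Lf (divr_gt0 (divr_gt0 eps0 (ltr0Sn R 1)) K0).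
have tth := bump_test bth; have Lth := test_Lfun2 tth.
have := cvg_ip_quotient (e := e) Lu tth; rewrite uv// opprK.
move/cvgrPdist_le => /(_ _ (divr_gt0 eps0 (ltr0Sn R 1))) H.
near=> s; have s0 : s != 0 by near: s; exact: nbhs_dnbhs_neq.
have Hs : `|ip v th - s^-1 * ip (fun x => u (x + s *: e) - u x) th| <= eps / 2.
  by near: s.
have Ls := Lfun2B (Lfun2_shift (s *: e) Lu) Lu.
have Lfth := Lfun2B Lf Lth.
have B1 : `|ip v (fun x => f x - th x)| <= n2 v * n2 (fun x => f x - th x).
  exact: cauchy_schwarz.
have B2 : `|s^-1 * ip (fun x => u (x + s *: e) - u x) (fun x => f x - th x)|
    <= n2 v * n2 (fun x => f x - th x).
  rewrite normrM normfV ler_pdivrMl ?normr_gt0// mulrA.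
  rewrite (le_trans (cauchy_schwarz Ls Lfth))// ler_wpM2r ?n2_ge0//.
  exact: n2_quotient_le.
have B3 : n2 v * n2 (fun x => f x - th x) <= eps / 2 / 2.
  rewrite (le_trans (ler_wpM2l (n2_ge0 _ _) fth))//.
  by rewrite mulrA ler_pdivrMr//; move: (n2_ge0 leb v) eps0; lra.
rewrite ipBr// in B1; rewrite ipBr// mulrBr in B2.
move: B1 B2 B3 Hs; set p := ip v f; set q := ip v th; set p' := _ * ip _ f.
set q' := _ * ip _ th; set z := n2 v * _.
rewrite !ler_norml => /andP[? ?] /andP[? ?] ? /andP[? ?]; apply/andP; split; lra.
Unshelve. all: by end_near. Qed.

End weak_derivatives.

(** * The modulus of a pair of Sobolev functions *)

Section regularized_modulus.
Context (R : realType) (eps : R).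
Context (eps0 : 0 < eps).
Implicit Types p q : R.

(* The regularization keeps the slopes (p' + p) / (|(p', q')| + |(p, q)|) Lipschitz
   near the origin; eps tends to 0 in weak_dir_modulus. *)
Definition rmod p q : R := Num.sqrt (eps ^+ 2 + p ^+ 2 + q ^+ 2).

Lemma rmod_sqr p q : rmod p q ^+ 2 = eps ^+ 2 + p ^+ 2 + q ^+ 2.
Proof. by rewrite sqr_sqrtr// !addr_ge0 ?sqr_ge0. Qed.

Lemma rmod_ge p q : eps <= rmod p q.
Proof.
rewrite -[leLHS]ger0_norm ?(ltW eps0)// -sqrtr_sqr ler_sqrt.
  by rewrite -addrA lerDl addr_ge0 ?sqr_ge0.
by rewrite !addr_ge0 ?sqr_ge0.
Qed.

Lemma rmod_gt0 p q : 0 < rmod p q.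
Proof. exact: lt_le_trans (rmod_ge _ _). Qed.

Lemma rmodC p q : rmod p q = rmod q p.
Proof. by rewrite /rmod addrAC. Qed.

Lemma norm_le_rmod p q : `|p| <= rmod p q.
Proof.
rewrite -sqrtr_sqr ler_sqrt; first by rewrite addrAC lerDr addr_ge0 ?sqr_ge0.
by rewrite !addr_ge0 ?sqr_ge0.
Qed.

(** Difference of squares over the sum: an exact discrete chain rule, whose coefficients are bounded
    by 1. *)
Lemma rmod_diff p q p' q' : rmod p' q' - rmod p q =
  (p' + p) / (rmod p' q' + rmod p q) * (p' - p) +
  (q' + q) / (rmod p' q' + rmod p q) * (q' - q).
Proof.
have n0 : rmod p' q' + rmod p q != 0 by rewrite gt_eqF// addr_gt0 ?rmod_gt0.
apply: (mulIf n0); rewrite -subr_sqr !rmod_sqr; field.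
by rewrite n0.
Qed.

Lemma rmod_slope_le1 p q p' q' : `|(p' + p) / (rmod p' q' + rmod p q)| <= 1.
Proof.
have n0 : 0 < rmod p' q' + rmod p q by rewrite addr_gt0 ?rmod_gt0.
rewrite normrM normfV (gtr0_norm n0) ler_pdivrMr// mul1r.
by rewrite (le_trans (ler_normD _ _))// lerD// norm_le_rmod.
Qed.

Lemma rmod_lipschitz p q p' q' :
  `|rmod p' q' - rmod p q| <= `|p' - p| + `|q' - q|.
Proof.
rewrite rmod_diff (le_trans (ler_normD _ _))// !normrM -!normrM.
rewrite lerD// normrM ler_piMl// ?rmod_slope_le1//.
by rewrite (rmodC p) (rmodC p') rmod_slope_le1.
Qed.

(** Over the common denominator the numerator is at most twice the increments, and the sum of the
    two moduli is at least [2 * eps]. *)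
Lemma rmod_slope_diff p q p' q' :
  `|(p' + p) / (rmod p' q' + rmod p q) - p / rmod p q| <=
  (`|p' - p| + `|q' - q|) / eps.
Proof.
have F0 := rmod_gt0 p q; have F'0 := rmod_gt0 p' q'.
have -> : (p' + p) / (rmod p' q' + rmod p q) - p / rmod p q =
  ((p' - p) - p / rmod p q * (rmod p' q' - rmod p q)) / (rmod p' q' + rmod p q).
  by field; rewrite !gt_eqF// addr_gt0.
have n0 : 0 < rmod p' q' + rmod p q by rewrite addr_gt0.
rewrite normrM normfV (gtr0_norm n0) ler_pdivrMr// [leRHS]mulrAC ler_pdivlMr//.
have pF : `|p / rmod p q| <= 1.
  by rewrite normrM normfV (gtr0_norm F0) ler_pdivrMr// mul1r norm_le_rmod.
have H : `|(p' - p) - p / rmod p q * (rmod p' q' - rmod p q)| <=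
    2 * (`|p' - p| + `|q' - q|).
  rewrite (le_trans (ler_normB _ _))// normrM.
  have := rmod_lipschitz p q p' q'.
  have : `|p / rmod p q| * `|rmod p' q' - rmod p q| <= `|rmod p' q' - rmod p q|.
    by rewrite ler_piMl.
  by have := normr_ge0 (q' - q); lra.
have H2 : 2 * eps <= rmod p' q' + rmod p q.
  by have := rmod_ge p q; have := rmod_ge p' q'; lra.
have D0 : 0 <= `|p' - p| + `|q' - q| by rewrite addr_ge0.
apply: (le_trans (ler_wpM2r (ltW eps0) H)).
by have := ler_wpM2l D0 H2; lra.
Qed.

End regularized_modulus.

Section modulus.
Context (R : realType) (N : nat).
Implicit Types (f u v w a b phi : 'rV[R]_N -> R) (x e h : 'rV[R]_N).
Local Notation leb := (@lebesgue_row R N).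
Local Notation L2 := (Lfun leb 2%:E).
Local Notation n2 := (norm2 leb).
Local Notation ip := (inner leb).

Lemma measurable_sqrt d (T : measurableType d) (g : T -> R) :
  measurable_fun setT g -> measurable_fun setT (fun t => Num.sqrt (g t)).
Proof.
move=> mf; have ms : measurable_fun [set: R] (@Num.sqrt R).
  by apply: continuous_measurable_fun; exact: sqrt_continuous.
exact: (measurableT_comp ms mf).
Qed.

(* Product of the weakly convergent quotient of u with the strongly convergent
   al_ s * phi. *)
Lemma cvg_quotient_mul u a e phi (al : 'rV[R]_N -> R)
    (al_ : R -> 'rV[R]_N -> R) (K : R) :
  u \in L2 -> a \in L2 -> phi \in L2 -> weak_dir e u a ->
  measurable_fun setT al -> (forall x, `|al x| <= 1) ->
  (forall s, measurable_fun setT (al_ s)) -> (forall s x, `|al_ s x| <= 1) ->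
  (forall s, n2 (fun x => (al_ s x - al x) * phi x) <= K * `|s|) ->
  s^-1 * ip (fun x => u (x + s *: e) - u x) (fun x => al_ s x * phi x)
    @[s --> 0^'] --> ip a (fun x => al x * phi x).
Proof.
move=> Lu La Lphi ua mal al1 mal_ al_1 HK.
have Lal : (fun x => al x * phi x) \in L2 by exact: Lfun2_bounded_mul al1.
have Lal_ s : (fun x => al_ s x * phi x) \in L2 by exact: Lfun2_bounded_mul (al_1 s).
have Ls s := Lfun2B (Lfun2_shift (s *: e) Lu) Lu.
have LD s : (fun x => (al_ s x - al x) * phi x) \in L2.
  rewrite (_ : (fun _ => _) = (fun x => al_ s x * phi x - al x * phi x)).
    exact: Lfun2B.
  by apply/funext => x; rewrite mulrBl.
have E s : s^-1 * ip (fun x => u (x + s *: e) - u x) (fun x => al_ s x * phi x) =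
    s^-1 * ip (fun x => u (x + s *: e) - u x) (fun x => al x * phi x) +
    s^-1 * ip (fun x => u (x + s *: e) - u x) (fun x => (al_ s x - al x) * phi x).
  rewrite -mulrDr -ipDr//; congr (_ * inner _ _ _); apply/funext => x; ring.
under eq_fun do rewrite E.
rewrite -(addr0 (ip a (fun x => al x * phi x))); apply: cvgD; first exact: cvg_weak_quotient.
apply/cvgr0Pnorm_le => d d0.
have K0 : 0 < n2 a * `|K| + 1 by rewrite ltr_wpDl// mulr_ge0 ?n2_ge0.
near=> s; have s0 : s != 0 by near: s; exact: nbhs_dnbhs_neq.
have sd : `|s| <= d / (n2 a * `|K| + 1).
  by near: s; apply: dnbhs0_le; exact: divr_gt0.
rewrite normrM normfV ler_pdivrMl ?normr_gt0//.
rewrite (le_trans (cauchy_schwarz (Ls s) (LD s)))//.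
have := ler_pM (n2_ge0 _ _) (n2_ge0 _ _) (n2_quotient_le s Lu La ua) (HK s).
move=> /le_trans; apply; rewrite -mulrA ler_wpM2l//.
rewrite ler_pdivlMr// in sd; apply: (le_trans _ sd).
rewrite mulrA [leRHS]mulrC ler_wpM2r//.
have := ler_wpM2l (n2_ge0 leb a) (ler_norm K); lra.
Unshelve. all: by end_near. Qed.

Lemma n2_mul_bounded_le (M : R) f phi : measurable_fun setT phi -> f \in L2 ->
  (forall x, `|phi x| <= M) -> n2 (fun x => f x * phi x) <= M * n2 f.
Proof.
move=> mphi Lf phiM.
have M0 : 0 <= M by rewrite (le_trans (normr_ge0 (phi 0)))//.
rewrite -(ger0_norm M0) -n2Z//; apply: le_n2; last 2 first.
- exact: Lfun2Z.
- move=> x; rewrite !normrM mulrC (ger0_norm M0) ler_wpM2r//.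
rewrite (_ : (fun _ => _) = (fun x => phi x * f x)).
  exact: Lfun2_bounded_mul phiM.
by apply/funext => x; rewrite mulrC.
Qed.

Section chain_rule.
Context (u w a b : 'rV[R]_N -> R) (e : 'rV[R]_N).
Context (Lu : u \in L2) (Lw : w \in L2) (La : a \in L2) (Lb : b \in L2).
Context (ua : weak_dir e u a) (wb : weak_dir e w b).

Let mu := Lfun2_measurable Lu.
Let mw := Lfun2_measurable Lw.

Lemma measurable_rmod (eps : R) : measurable_fun setT (fun x => rmod eps (u x) (w x)).
Proof.
apply: measurable_sqrt; apply: measurable_funD; last exact: measurable_funX.
by apply: measurable_funD => //; exact: measurable_funX.
Qed.

Definition modulus x := Num.sqrt (u x ^+ 2 + w x ^+ 2).

Lemma modulus_Lfun2 : modulus \in L2.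
Proof.
apply: (@Lfun2_dominated _ _ _ _ _ (fun x => `|u x| + `|w x|)).
- by apply: measurable_sqrt; apply: measurable_funD; exact: measurable_funX.
- apply: Lfun2D.
    by apply: (Lfun2_dominated _ Lu) => [|x]; rewrite ?normr_id//; exact: measurableT_comp.
  by apply: (Lfun2_dominated _ Lw) => [|x]; rewrite ?normr_id//; exact: measurableT_comp.
move=> x; rewrite ger0_norm ?sqrtr_ge0// ger0_norm ?addr_ge0//.
rewrite -[leRHS]ger0_norm ?addr_ge0// -sqrtr_sqr ler_sqrt ?sqr_ge0//.
rewrite sqrrD !real_normK ?num_real// -addrA lerD2l lerDr mulrn_wge0//.
Qed.

(** [rmod eps] stays above eps, which is incompatible with square integrability on a space of
    infinite measure. After subtraction of eps it lies below the modulus, since sqrt(eps^2 + m^2) <=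
    eps + m. *)
Lemma rmod_itv (eps : R) x : 0 < eps ->
  0 <= rmod eps (u x) (w x) - eps <= modulus x.
Proof.
move=> eps0; rewrite subr_ge0 rmod_ge//= lerBlDr.
have m0 : 0 <= modulus x by exact: sqrtr_ge0.
rewrite -(@ler_pXn2r _ 2) ?nnegrE ?(ltW (rmod_gt0 _ _ _))// ?addr_ge0 ?(ltW eps0)//.
rewrite rmod_sqr sqrrD sqr_sqrtr ?addr_ge0 ?sqr_ge0//.
have : 0 <= modulus x * eps by rewrite mulr_ge0// ltW.
by rewrite -mulr_natl; lra.
Qed.

Lemma rmod_Lfun2 (eps : R) : 0 < eps ->
  (fun x => rmod eps (u x) (w x) - eps) \in L2.
Proof.
move=> eps0; apply: (Lfun2_dominated _ modulus_Lfun2).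
  by apply: measurable_funB => //; exact: measurable_rmod.
move=> x; have /andP[p0 p1] := rmod_itv x eps0.
by rewrite ger0_norm// ger0_norm// (le_trans p0).
Qed.

Lemma rmod_slope_bound (eps : R) x : 0 < eps -> `|u x / rmod eps (u x) (w x)| <= 1.
Proof.
move=> eps0; have F0 := rmod_gt0 eps0 (u x) (w x).
by rewrite normrM normfV (gtr0_norm F0) ler_pdivrMr// mul1r norm_le_rmod.
Qed.

Lemma measurable_quotient (f g : 'rV[R]_N -> R) : measurable_fun setT f ->
  measurable_fun setT g -> (forall x, 0 < g x) ->
  measurable_fun setT (fun x => f x / g x).
Proof.
move=> mf mg g0; apply: measurable_funM => //.
have -> : (fun x => (g x)^-1) = (fun x => g x `^ (-1)).
  by apply/funext => x; rewrite powR_inv1// ltW.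
exact: (measurableT_comp (measurable_powR _) mg).
Qed.

Lemma cvg_rmod_quotient (eps : R) phi : 0 < eps -> test_function phi ->
  s^-1 * ip (fun x => u (x + s *: e) - u x) (fun x =>
    (u (x + s *: e) + u x) / (rmod eps (u (x + s *: e)) (w (x + s *: e)) +
       rmod eps (u x) (w x)) * phi x) @[s --> 0^'] -->
  ip a (fun x => u x / rmod eps (u x) (w x) * phi x).
Proof.
move=> eps0 tphi; have Lphi := test_Lfun2 tphi.
have cphi := test_continuous tphi.
have [M [r [phiM _]]] := compact_support_bounded cphi tphi.2.
have M0 : 0 <= M by rewrite (le_trans (normr_ge0 (phi 0)))//.
have mF := measurable_rmod eps.
have F0 x := rmod_gt0 eps0 (u x) (w x).
have mal_ s : measurable_fun setT (fun x => (u (x + s *: e) + u x) /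
    (rmod eps (u (x + s *: e)) (w (x + s *: e)) + rmod eps (u x) (w x))).
  apply: measurable_quotient.
  - by apply: measurable_funD => //; exact: measurable_fun_shift.
  - by apply: measurable_funD => //; exact: (measurable_fun_shift _ mF).
  - by move=> x; rewrite addr_gt0.
have mal : measurable_fun setT (fun x => u x / rmod eps (u x) (w x)).
  exact: measurable_quotient.
(* In the constant, M bounds phi, 1 / eps is the Lipschitz constant of the slopes, and |a| + |b|
   bounds the quotients of u and w in L2. *)
apply: (@cvg_quotient_mul u a e phi (fun x => u x / rmod eps (u x) (w x))
  (fun s x => (u (x + s *: e) + u x) / (rmod eps (u (x + s *: e)) (w (x + s *: e)) +
       rmod eps (u x) (w x))) (M * ((n2 a + n2 b) / eps))) => //.
- by move=> x; exact: rmod_slope_bound.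
- by move=> s x; exact: rmod_slope_le1.
move=> s.
have Lus := Lfun2B (Lfun2_shift (s *: e) Lu) Lu.
have Lws := Lfun2B (Lfun2_shift (s *: e) Lw) Lw.
have Labs f : f \in L2 -> (fun x => `|f x|) \in L2.
  move=> Lf; apply: (Lfun2_dominated _ Lf) => [|x]; rewrite ?normr_id//.
  by apply: measurableT_comp => //; exact: Lfun2_measurable Lf.
have n2abs f : f \in L2 -> n2 (fun x => `|f x|) <= n2 f.
  by move=> Lf; apply: le_n2 => // [|x]; [exact: Labs|rewrite normr_id].
pose D x := eps^-1 * (`|u (x + s *: e) - u x| + `|w (x + s *: e) - w x|).
have LD : D \in L2 by apply: Lfun2Z; apply: Lfun2D; exact: Labs.
have Dle x : `|(u (x + s *: e) + u x) / (rmod eps (u (x + s *: e)) (w (x + s *: e)) +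
    rmod eps (u x) (w x)) - u x / rmod eps (u x) (w x)| <= `|D x|.
  apply: (le_trans (rmod_slope_diff _ _ _ _ _)) => //.
  by rewrite /D mulrC ler_norm.
have Ldiff : (fun x => (u (x + s *: e) + u x) / (rmod eps (u (x + s *: e)) (w (x + s *: e)) +
    rmod eps (u x) (w x)) - u x / rmod eps (u x) (w x)) \in L2.
  by apply: Lfun2_dominated LD Dle; exact: measurable_funB.
have mphi := Lfun2_measurable Lphi.
rewrite (le_trans (n2_mul_bounded_le mphi Ldiff phiM))// -mulrA ler_wpM2l//.
rewrite (le_trans (le_n2 Ldiff LD Dle))// /D n2Z; last by apply: Lfun2D; exact: Labs.
rewrite gtr0_norm ?invr_gt0// mulrAC mulrC ler_pM2r ?invr_gt0//.
rewrite (le_trans (n2D (Labs _ Lus) (Labs _ Lws)))// mulrDl.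
by rewrite lerD// (le_trans (n2abs _ _))// mulrC n2_quotient_le.
Qed.

End chain_rule.

(** The limit of the quotients of [g] paired with phi is computed twice, by moving them onto phi and
    by the discrete chain rule [rmod_diff]. Uniqueness of the limit identifies the weak
    derivative. *)
Lemma weak_dir_rmod u w a b e (eps : R) : u \in L2 -> w \in L2 -> a \in L2 ->
  b \in L2 -> weak_dir e u a -> weak_dir e w b -> 0 < eps ->
  weak_dir e (fun x => rmod eps (u x) (w x) - eps)
    (fun x => u x / rmod eps (u x) (w x) * a x + w x / rmod eps (u x) (w x) * b x).
Proof.
move=> Lu Lw La Lb ua wb eps0 phi tphi; have Lphi := test_Lfun2 tphi.
have Lg := rmod_Lfun2 Lu Lw eps0.
set g := (fun x => _) in Lg *.
have mu := Lfun2_measurable Lu; have mw := Lfun2_measurable Lw.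
have mF := measurable_rmod Lu Lw eps.
have F0 x := rmod_gt0 eps0 (u x) (w x).
have mal : measurable_fun setT (fun x => u x / rmod eps (u x) (w x)).
  exact: measurable_quotient.
have mbe : measurable_fun setT (fun x => w x / rmod eps (u x) (w x)).
  exact: measurable_quotient.
have al1 x := rmod_slope_bound u w x eps0.
have be1 x : `|w x / rmod eps (u x) (w x)| <= 1.
  by rewrite rmodC; exact: (rmod_slope_bound w u x eps0).
have Lala := Lfun2_bounded_mul mal La al1.
have Lbeb := Lfun2_bounded_mul mbe Lb be1.
have H1 := cvg_ip_quotient (e := e) Lg tphi.
have H2 := cvgD (cvg_rmod_quotient Lu Lw La Lb ua wb eps0 tphi)
  (cvg_rmod_quotient Lw Lu Lb La wb ua eps0 tphi).
have rC p q : rmod eps p q = rmod eps q p by exact: rmodC.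
have E (s : R) : s^-1 * ip (fun x => g (x + s *: e) - g x) phi =
  s^-1 * ip (fun x => u (x + s *: e) - u x) (fun x =>
    (u (x + s *: e) + u x) / (rmod eps (u (x + s *: e)) (w (x + s *: e)) +
       rmod eps (u x) (w x)) * phi x) +
  s^-1 * ip (fun x => w (x + s *: e) - w x) (fun x =>
    (w (x + s *: e) + w x) / (rmod eps (w (x + s *: e)) (u (x + s *: e)) +
       rmod eps (w x) (u x)) * phi x).
  have Lus := Lfun2B (Lfun2_shift (s *: e) Lu) Lu.
  have Lws := Lfun2B (Lfun2_shift (s *: e) Lw) Lw.
  have mus := measurable_fun_shift (s *: e) mu.
  have mws := measurable_fun_shift (s *: e) mw.
  have mFs := measurable_fun_shift (s *: e) mF.
  rewrite -mulrDr -RintegralD//; last 2 first.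
  - apply: Lfun2_mul => //; apply: (Lfun2_bounded_mul _ Lphi); last first.
      by move=> x; exact: rmod_slope_le1.
    apply: measurable_quotient; last by move=> x; rewrite addr_gt0.
      exact: measurable_funD.
    exact: measurable_funD.
  - apply: Lfun2_mul => //; apply: (Lfun2_bounded_mul _ Lphi); last first.
      by move=> x; exact: rmod_slope_le1.
    apply: measurable_quotient; last by move=> x; rewrite addr_gt0// rC.
      exact: measurable_funD.
    by apply: measurable_funD; under eq_fun do rewrite rC.
  congr (_ * _); apply: eq_Rintegral => x _.
  rewrite /g opprB addrA subrK rmod_diff// (rC (w (x + _))) (rC (w x)); ring.
have {}H2 : s^-1 * ip (fun x => g (x + s *: e) - g x) phi @[s --> 0^'] -->
    ip a (fun x => u x / rmod eps (u x) (w x) * phi x) +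
    ip b (fun x => w x / rmod eps (w x) (u x) * phi x).
  by under eq_fun do rewrite E; exact: H2.
rewrite -[LHS]opprK; congr (- _).
rewrite -(cvg_lim (@Rhausdorff R) H1) (cvg_lim (@Rhausdorff R) H2).
rewrite -RintegralD//; last 2 first.
- by apply: Lfun2_mul => //; exact: Lfun2_bounded_mul al1.
- apply: Lfun2_mul => //; under eq_fun do rewrite rC.
  exact: Lfun2_bounded_mul be1.
by apply: eq_Rintegral => x _; rewrite (rC (w x)); ring.
Qed.

Lemma cvg_rmod (p q : R) :
  rmod (n.+1%:R^-1) p q @[n --> \oo] --> Num.sqrt (p ^+ 2 + q ^+ 2).
Proof.
apply: continuous_cvg; first exact: sqrt_continuous.
rewrite (_ : (fun n => _) =
    (fun n => (n.+1%:R^-1 * n.+1%:R^-1) + (p ^+ 2 + q ^+ 2) : R)); last first.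
  by apply/funext => n; rewrite -addrA expr2.
have c : (n.+1%:R^-1 : R) @[n --> \oo] --> (0 : R) by exact: cvg_harmonic.
have H : (n.+1%:R^-1 * n.+1%:R^-1 : R) @[n --> \oo] --> (0 : R).
  by rewrite -[X in _ --> X](mulr0 (0 : R)); exact: cvgM.
have := cvgD H (cvg_cst (p ^+ 2 + q ^+ 2)).
by rewrite add0r; exact.
Qed.

(* Where the modulus vanishes so do u and w, and the quotients below are 0 / 0 = 0. *)
Lemma weak_dir_modulus u w a b e : u \in L2 -> w \in L2 -> a \in L2 ->
  b \in L2 -> weak_dir e u a -> weak_dir e w b ->
  let v := (fun x => u x / modulus u w x * a x + w x / modulus u w x * b x) in
  v \in L2 /\ weak_dir e (modulus u w) v.
Proof.
move=> Lu Lw La Lb ua wb v.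
have mu := Lfun2_measurable Lu; have mw := Lfun2_measurable Lw.
pose ep n : R := n.+1%:R^-1; have ep0 n : 0 < ep n by rewrite invr_gt0 ltr0n.
pose g_ n x := rmod (ep n) (u x) (w x) - ep n.
pose v_ n x := u x / rmod (ep n) (u x) (w x) * a x + w x / rmod (ep n) (u x) (w x) * b x.
have be1 n x : `|w x / rmod (ep n) (u x) (w x)| <= 1.
  by rewrite rmodC; exact: (rmod_slope_bound w u x (ep0 n)).
have al1 n x := rmod_slope_bound u w x (ep0 n).
have F0 n x := rmod_gt0 (ep0 n) (u x) (w x).
have Lv_ n : v_ n \in L2.
  by apply: Lfun2D; [apply: Lfun2_bounded_mul (al1 n) => //|
    apply: Lfun2_bounded_mul (be1 n) => //];
    apply: measurable_quotient => //; exact: measurable_rmod.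
have Labs f : f \in L2 -> (fun x => `|f x|) \in L2.
  move=> Lf; apply: (Lfun2_dominated _ Lf) => [|x]; rewrite ?normr_id//.
  by apply: measurableT_comp => //; exact: Lfun2_measurable Lf.
(* The slopes are at most 1 whatever the regularization, so |a| + |b| dominates every [v_ n]. *)
have LD := Lfun2D (Labs _ La) (Labs _ Lb).
have v_D n x : `|v_ n x| <= `| `|a x| + `|b x| |.
  rewrite [leRHS]ger0_norm ?addr_ge0// (le_trans (ler_normD _ _))// !normrM.
  by rewrite lerD// -normrM ler_piMl.
have m0 x : 0 <= modulus u w x by exact: sqrtr_ge0.
have v_v x : v_ n x @[n --> \oo] --> v x.
  have mx := @cvg_rmod (u x) (w x).
  have [m0'|mn0] := eqVneq (modulus u w x) 0.
    have : u x ^+ 2 + w x ^+ 2 = 0.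
      have : modulus u w x ^+ 2 = 0 by rewrite m0' expr0n.
      by rewrite sqr_sqrtr// addr_ge0 ?sqr_ge0.
    move/eqP; rewrite paddr_eq0 ?sqr_ge0// !sqrf_eq0 => /andP[/eqP u0 /eqP w0].
    rewrite /v (_ : (fun n => v_ n x) = cst 0) ?u0 ?w0 ?mul0r ?addr0 ?mul0r.
      exact: cvg_cst.
    by apply/funext => n; rewrite /v_ u0 w0 !mul0r addr0.
  by apply: cvgD; apply: cvgMl; apply: cvgMr; apply: cvgV.
have g_g x : g_ n x @[n --> \oo] --> modulus u w x.
  have := cvgB (@cvg_rmod (u x) (w x)) (@cvg_harmonic R).
  by rewrite subr0; exact.
have Lm := modulus_Lfun2 Lu Lw.
have g_m n x : `|g_ n x| <= `|modulus u w x|.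
  have /andP[p0 p1] := rmod_itv u w x (ep0 n).
  by rewrite ger0_norm// ger0_norm.
have Lg_ n := rmod_Lfun2 Lu Lw (ep0 n).
have [Lv _] := n2_dominated_cvg Lv_ LD v_D v_v.
split=> // phi tphi; have Lphi := test_Lfun2 tphi.
have LDphi := test_Lfun2 (test_derive e tphi).
have H1 := cvg_ip_dominated Lg_ Lm LDphi g_m g_g.
have H2 : - ip (v_ n) phi @[n --> \oo] --> - ip v phi.
  by apply: cvgN; exact: cvg_ip_dominated Lv_ LD Lphi v_D v_v.
rewrite -(cvg_lim (@Rhausdorff R) H1) -(cvg_lim (@Rhausdorff R) H2).
rewrite (_ : (fun n => _) = (fun n => - ip (v_ n) phi))//.
by apply/funext => n; exact: (weak_dir_rmod Lu Lw La Lb ua wb (ep0 n)).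
Qed.

End modulus.

Section sobolev_modulus.
Context (R : realType) (N : nat).
Implicit Types (f u v w phi : 'rV[R]_N -> R) (x e y : 'rV[R]_N) (i : 'I_N).
Local Notation leb := (@lebesgue_row R N).
Local Notation L2 := (Lfun leb 2%:E).
Local Notation n2 := (norm2 leb).
Local Notation ip := (inner leb).

Definition dpart i u x : R := grad u x ord0 i.

Lemma sobolevH1_Lfun2 u : sobolevH1 u -> u \in L2.
Proof. by case. Qed.

Lemma dpartP i u : sobolevH1 u ->
  dpart i u \in L2 /\ weak_dir (delta_mx ord0 i) u (dpart i u).
Proof.
move=> [Lu /(_ i)[v Lv uv]].
pose P := [set v | spaceL2 v /\ weak_partial i u v].
have E : dpart i u = xget (fun=> 0) P by apply/funext => x; rewrite /dpart mxE.
by rewrite E; have [] : P (xget (fun=> 0) P) by apply: (xgetPex (fun=> 0)); exists v.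
Qed.

Lemma normL2_sqr u : u \in L2 -> normL2 u ^+ 2 = n2 u ^+ 2.
Proof. exact: Lnorm2_sqr. Qed.

Lemma normL2_grad u : sobolevH1 u ->
  normL2 (enorm \o grad u) ^+ 2 = \sum_(i < N) n2 (dpart i u) ^+ 2.
Proof.
move=> Hu; have Ld i : dpart i u \in L2 by case: (dpartP i Hu).
have Lsum : (fun x => \sum_(i < N) `|dpart i u x|) \in L2.
  apply: Lfun2_sum => i; apply: (Lfun2_dominated _ (Ld i)) => [|x].
    by apply: measurableT_comp => //; exact: Lfun2_measurable (Ld i).
  by rewrite normr_id.
have eE x : (enorm \o grad u) x = Num.sqrt (\sum_(i < N) dpart i u x ^+ 2).
  by rewrite /= /enorm /dot; congr Num.sqrt; apply: eq_bigr => i _; rewrite expr2.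
have S0 x : 0 <= \sum_(i < N) dpart i u x ^+ 2.
  by apply: sumr_ge0 => i _; exact: sqr_ge0.
have Lg : enorm \o grad u \in L2.
  apply: (Lfun2_dominated _ Lsum).
    rewrite (_ : enorm \o grad u = fun x => Num.sqrt (\sum_(i < N) dpart i u x ^+ 2)).
      apply: measurable_sqrt; apply: measurable_sum => i.
      by apply: measurable_funX; exact: Lfun2_measurable (Ld i).
    exact/funext.
  move=> x; rewrite eE ger0_norm ?sqrtr_ge0//.
  have T0 : 0 <= \sum_(i < N) `|dpart i u x| by apply: sumr_ge0.
  rewrite -sqrtr_sqr ler_sqrt ?sqr_ge0//.
  rewrite expr2 mulr_suml; apply: ler_sum => i _.
  rewrite -[leLHS]real_normK ?num_real// expr2 ler_wpM2l//.
  by rewrite (bigD1 i)//= lerDl sumr_ge0.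
rewrite normL2_sqr// n2_sqrE.
transitivity (\int[leb]_x (\sum_(i < N) dpart i u x ^+ 2)).
  by apply: eq_Rintegral => x _; rewrite eE sqr_sqrtr.
rewrite /Rintegral (eq_integral (fun x => \sum_(i < N) (dpart i u x ^+ 2)%:E)%E); last first.
  by move=> x _; rewrite sumEFin.
rewrite ge0_integral_sum//; last 2 first.
- by move=> i; apply/measurable_EFinP/measurable_funX; exact: Lfun2_measurable (Ld i).
- by move=> i x _; rewrite lee_fin sqr_ge0.
under eq_bigr do rewrite (n2_sqr_EFin (Ld _)).
by rewrite sumEFin.
Qed.

Lemma weak_dir_shift e u v y : u \in L2 -> v \in L2 -> weak_dir e u v ->
  weak_dir e (fun x => u (x + y)) (fun x => v (x + y)).
Proof.
move=> Lu Lv uv phi tphi; have tphiy := test_shift (- y) tphi.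
rewrite !shiftB_ip//; last 2 first.
- exact: test_Lfun2.
- exact/test_Lfun2/test_derive.
rewrite -(uv _ tphiy); apply: eq_Rintegral => x _; congr (_ * _).
by rewrite derive_shift_row.
Qed.

Lemma sobolevH1_shift u y : sobolevH1 u -> sobolevH1 (fun x => u (x + y)).
Proof.
move=> Hu; have Lu := sobolevH1_Lfun2 Hu; split; first exact: Lfun2_shift.
move=> i; have [Ld ud] := dpartP i Hu.
exists (fun x => dpart i u (x + y)); first exact: Lfun2_shift.
exact: weak_dir_shift.
Qed.

Lemma sobolevH1_modulus u w : sobolevH1 u -> sobolevH1 w -> sobolevH1 (modulus u w).
Proof.
move=> Hu Hw; have Lu := sobolevH1_Lfun2 Hu; have Lw := sobolevH1_Lfun2 Hw.
split; first exact: modulus_Lfun2.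
move=> i; have [La ua] := dpartP i Hu; have [Lb wb] := dpartP i Hw.
by have [Lv mv] := weak_dir_modulus Lu Lw La Lb ua wb; eexists; first exact: Lv.
Qed.

Lemma n2_modulus u w : u \in L2 -> w \in L2 ->
  n2 (modulus u w) ^+ 2 = n2 u ^+ 2 + n2 w ^+ 2.
Proof.
move=> /Lfun2P[_ Iu] /Lfun2P[_ Iw]; rewrite !n2_sqrE -RintegralD//.
by apply: eq_Rintegral => x _; rewrite sqr_sqrtr// addr_ge0 ?sqr_ge0.
Qed.

(** Reverse triangle inequality in the plane; [H] is Cauchy-Schwarz there. *)
Lemma modulus_diff_le (p q p' q' : R) :
  `|Num.sqrt (p' ^+ 2 + q' ^+ 2) - Num.sqrt (p ^+ 2 + q ^+ 2)| <=
  Num.sqrt ((p' - p) ^+ 2 + (q' - q) ^+ 2).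
Proof.
have S0 (a b : R) : 0 <= a ^+ 2 + b ^+ 2 by rewrite addr_ge0 ?sqr_ge0.
rewrite -sqrtr_sqr ler_sqrt// sqrrB !sqr_sqrtr// -mulr_natl.
have H : p' * p + q' * q <= Num.sqrt (p' ^+ 2 + q' ^+ 2) * Num.sqrt (p ^+ 2 + q ^+ 2).
  rewrite -sqrtrM// (le_trans (ler_norm _))// -sqrtr_sqr ler_sqrt ?mulr_ge0//.
  by have := sqr_ge0 (p' * q - q' * p); nra.
by have := H; nra.
Qed.

(** Differences of the modulus lie pointwise below the modulus of the differences, whose squared L2
    norm is a sum of two terms, each controlled by a weak derivative. The bound then returns to [v]
    by [n2_weak_dir_le]. Here [v] is arbitrary because [grad] picks an unspecified
    representative. *)
Lemma n2_weak_dir_modulus_shift e u w a b v y :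
  u \in L2 -> w \in L2 -> a \in L2 -> b \in L2 -> v \in L2 ->
  weak_dir e u a -> weak_dir e w b ->
  weak_dir e (modulus u (fun x => w (x + y))) v ->
  n2 v ^+ 2 <= n2 a ^+ 2 + n2 b ^+ 2.
Proof.
move=> Lu Lw La Lb Lv ua wb mv; have Lwy := Lfun2_shift y Lw.
have LM := modulus_Lfun2 Lu Lwy.
have C0 : 0 <= n2 a ^+ 2 + n2 b ^+ 2 by rewrite addr_ge0 ?sqr_ge0.
suff : n2 v <= Num.sqrt (n2 a ^+ 2 + n2 b ^+ 2).
  move=> H; rewrite -(sqr_sqrtr C0).
  by apply: lerXn2r; rewrite ?nnegrE ?n2_ge0 ?sqrtr_ge0.
apply: (n2_weak_dir_le LM Lv mv); first exact: sqrtr_ge0.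
move=> s; have Lus := Lfun2B (Lfun2_shift (s *: e) Lu) Lu.
have Lws := Lfun2B (Lfun2_shift (s *: e) Lw) Lw.
have Lwys := Lfun2B (Lfun2_shift (s *: e) Lwy) Lwy.
have Lms := Lfun2B (Lfun2_shift (s *: e) LM) LM.
have LMd := modulus_Lfun2 Lus Lwys.
have := le_n2 Lms LMd.
move=> /(_ _)/le_trans; apply.
  by move=> x; rewrite [leRHS]ger0_norm ?sqrtr_ge0//; exact: modulus_diff_le.
have Eu := n2_quotient_le s Lu La ua.
have Ew := n2_quotient_le s Lw Lb wb.
have Ewy : n2 (fun x => w (x + s *: e + y) - w (x + y)) =
    n2 (fun x => w (x + s *: e) - w x).
  rewrite -(n2_shift y Lws); congr norm2; apply/funext => x.
  by rewrite addrAC.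
have EM := n2_modulus Lus Lwys; rewrite Ewy in EM.
move: Eu Ew EM; move: (n2_ge0 leb (fun x => u (x + s *: e) - u x)).
move: (n2_ge0 leb (fun x => w (x + s *: e) - w x)).
move: (n2_ge0 leb (modulus (fun x => u (x + s *: e) - u x)
  (fun x => w (x + s *: e + y) - w (x + y)))).
set M := n2 (modulus _ _); set U := n2 (fun x => u _ - _).
set W := n2 (fun x => w (x + _) - w x) => M0 W0 U0 HU HW EM.
suff : M <= `|s| * Num.sqrt (n2 a ^+ 2 + n2 b ^+ 2) by [].
rewrite -(@ler_pXn2r _ 2) ?nnegrE ?mulr_ge0 ?sqrtr_ge0//.
rewrite [leRHS]exprMn [X in _ * X]sqr_sqrtr// EM mulrDr -!exprMn.
by apply: lerD; apply: lerXn2r; rewrite ?nnegrE ?mulr_ge0 ?n2_ge0.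
Qed.

Lemma normL2_grad_modulus u w y : sobolevH1 u -> sobolevH1 w ->
  normL2 (enorm \o grad (modulus u (fun x => w (x + y)))) ^+ 2 <=
  normL2 (enorm \o grad u) ^+ 2 + normL2 (enorm \o grad w) ^+ 2.
Proof.
move=> Hu Hw; have Hm := sobolevH1_modulus Hu (sobolevH1_shift y Hw).
rewrite (normL2_grad Hm) (normL2_grad Hu) (normL2_grad Hw) -big_split/=.
apply: ler_sum => i _; have [La ua] := dpartP i Hu; have [Lb wb] := dpartP i Hw.
have [Lm um] := dpartP i Hm.
exact: (n2_weak_dir_modulus_shift (sobolevH1_Lfun2 Hu) (sobolevH1_Lfun2 Hw)
  La Lb Lm ua wb um).
Qed.

End sobolev_modulus.

(** * Subcritical integrability *)

Section weak_Lp.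
Context d (T : measurableType d) (R : realType) (mu : {measure set T -> \bar R}).
Implicit Types u : T -> R.

(** For z <= 1 the square suffices; otherwise k is the dyadic level with 2^k < z <= 2^(k+1). The
    coerced boolean becomes the indicator of a level set. *)
Lemma dyadic_bound (p : R) (z : R) : 2 <= p -> 0 <= z ->
  exists k : nat, z `^ p <= z ^+ 2 + (2 `^ p) ^+ k.+1 * (2 ^+ k < z)%R%:R.
Proof.
move=> p2 z0; have [z1|z1] := leP z 1.
  exists 0%N; rewrite (@le_trans _ _ (z ^+ 2))//.
    rewrite -powR_mulrn//; have [->|zn0] := eqVneq z 0.
      by rewrite !powR0 ?gt_eqF// (lt_le_trans _ p2).
    by apply: ger_powR => //; rewrite lt_def zn0 z0 z1.
  by rewrite lerDl mulr_ge0// exprn_ge0// powR_ge0.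
have [m Hm Hmin] : exists2 m, z <= 2 ^+ m & forall m', z <= 2 ^+ m' -> (m <= m')%N.
  have exm : exists m, z <= 2 ^+ m.
    exists (Num.bound z); rewrite ltW// (lt_le_trans (archi_boundP z0))//.
    by rewrite -natrX ler_nat ltnW// ltn_expl.
  by exists (ex_minn exm); case: ex_minnP.
(* The least exponent m with z <= 2^m is positive because z > 1, so that k = m - 1. *)
case: m => [|k] in Hm Hmin *; first by move: Hm; rewrite expr0 leNgt z1.
have kz : 2 ^+ k < z.
  by rewrite ltNge; apply/negP => /Hmin; rewrite ltnn.
exists k; rewrite kz mulr1 (@le_trans _ _ ((2 ^+ k.+1) `^ p))//.
  by apply: ge0_ler_powR; rewrite ?nnegrE ?exprn_ge0// (le_trans _ p2).
rewrite (_ : (2 ^+ k.+1) `^ p = (2 `^ p) ^+ k.+1) ?lerDr ?sqr_ge0//.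
by rewrite -(powR_mulrn _ (ler0n R 2)) -(powR_mulrn _ (powR_ge0 2 p)) -!powRrM mulrC.
Qed.

(** Beyond the L2 mass, level k costs at most 2^(p (k+1)) K 2^(-s k): a geometric series of ratio
    2^(p - s) < 1. *)
Lemma weak_Lp_integrable u (p s K : R) : u \in Lfun mu 2%:E -> 2 < p -> p < s ->
  (forall k, mu [set x | 2 ^+ k < `|u x|]%R <= (K * (2 `^ (- s)) ^+ k)%:E)%E ->
  mu.-integrable setT (EFin \o (fun x => `|u x| `^ p)).
Proof.
move=> Lu p2 ps HK; have mu' := Lfun2_measurable Lu.
have mabs : measurable_fun setT (fun x => `|u x|) by exact: measurableT_comp.
have mp : measurable_fun setT (fun x => `|u x| `^ p).
  exact: (measurableT_comp (measurable_powR _) mabs).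
apply/integrableP; split; first exact/measurable_EFinP.
pose A k := [set x | 2 ^+ k < `|u x|]%R.
have mA k : measurable (A k).
  rewrite (_ : A k = (fun x => `|u x|) @^-1` `]2 ^+ k, +oo[); last first.
    by apply/seteqP; split=> x; rewrite /A /= in_itv/= andbT.
  by rewrite -[X in measurable X]setTI; apply: mabs => //; exact: measurable_itv.
pose b : R := 2 `^ p; have b0 : 0 <= b by exact: powR_ge0.
pose g k x := (b ^+ k.+1 * \1_(A k) x)%:E.
have g0 k x : (0 <= g k x)%E by rewrite lee_fin mulr_ge0// exprn_ge0.
have mg k : measurable_fun setT (g k).
  by apply/measurable_EFinP/measurable_funM => //; exact: measurable_indic.
have msum : measurable_fun setT (fun x => \sum_(k <oo) g k x)%E.
  exact: (@ge0_emeasurable_sum _ _ _ _ g xpredT).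
apply: (@le_lt_trans _ _ (\int[mu]_x ((u x ^+ 2)%:E + \sum_(k <oo) g k x))%E).
  apply: ge0_le_integral => //.
  - by do 2 apply: measurableT_comp => //; exact/measurable_EFinP.
  - by apply: emeasurable_funD => //; exact/measurable_EFinP/measurable_funX.
  move=> x _; rewrite /= ger0_norm ?powR_ge0//.
  have [k Hk] := dyadic_bound (ltW p2) (normr_ge0 (u x)).
  rewrite (@le_trans _ _ ((u x ^+ 2)%:E + g k x)%E)//.
    rewrite -EFinD lee_fin (le_trans Hk)// real_normK ?num_real// lerD2l.
    rewrite indicE (_ : (x \in A k) = (2 ^+ k < `|u x|)%R)//.
    by apply/idP/idP => [/set_mem//|H]; exact: mem_set.
  rewrite leeD2l// (@nneseriesD1 _ _ k)//.
  by rewrite leeDl// nneseries_ge0.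
rewrite ge0_integralD//; last 3 first.
- by move=> x _; rewrite lee_fin sqr_ge0.
- exact/measurable_EFinP/measurable_funX.
- by move=> x _; exact: nneseries_ge0.
rewrite n2_sqr_EFin// integral_nneseries//.
pose r : R := b * 2 `^ (- s).
have r0 : 0 <= r by rewrite mulr_ge0// powR_ge0.
have r1 : r < 1.
  rewrite /r /b -powRD; last by rewrite pnatr_eq0 implybT.
  rewrite /powR gt_eqF// expR_lt1 pmulr_llt0 ?subr_lt0//.
  by rewrite ln_gt0// ltr1n.
have K0 : 0 <= K.
  have := le_trans (measure_ge0 mu _) (HK 0%N).
  by rewrite expr0 mulr1 lee_fin.
have Hg k : (\int[mu]_x g k x <= (K * b * r ^+ k)%:E)%E.
  rewrite /g; under eq_integral do rewrite EFinM.
  rewrite ge0_integralZl_EFin//; last 2 first.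
  - by apply/measurable_EFinP/measurable_indic.
  - by rewrite exprn_ge0.
  rewrite integral_indic// setIT.
  apply: (@le_trans _ _ ((b ^+ k.+1)%:E * (K * (2 `^ (- s)) ^+ k)%:E)%E).
    by apply: lee_wpmul2l; [rewrite lee_fin exprn_ge0|exact: HK].
  by rewrite -EFinM lee_fin /r exprMn exprS le_eqVlt; apply/orP; left; apply/eqP; ring.
rewrite lte_add_pinfty ?ltry//.
apply: (@le_lt_trans _ _ (K * b / (1 - r))%:E); last by rewrite ltry.
apply: lime_le; first by apply: is_cvg_nneseries => k _ _; exact: integral_ge0.
apply: nearW => m; rewrite (@le_trans _ _ (\sum_(0 <= k < m) (K * b * r ^+ k)%:E)%E)//.
  by apply: lee_sum => k _; exact: Hg.
rewrite sumEFin lee_fin.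
have -> : \sum_(0 <= k < m) K * b * r ^+ k = series (geometric (K * b) r) m by [].
rewrite geometric_seriesE ?lt_eqF//= ler_wpM2r ?invr_ge0 ?subr_ge0 ?(ltW r1)//.
by rewrite ler_piMr ?mulr_ge0// lerBlDr lerDl exprn_ge0.
Qed.

End weak_Lp.

(** * From translation estimates to integrable powers on H^1 *)

Section embedding.
Context (R : realType) (N : nat).
Implicit Types (f u v w phi : 'rV[R]_N -> R) (x e y h : 'rV[R]_N) (i : 'I_N).
Local Notation leb := (@lebesgue_row R N).
Local Notation L2 := (Lfun leb 2%:E).
Local Notation n2 := (norm2 leb).

Lemma n2_shiftB_le_sum u h : sobolevH1 u ->
  n2 (fun x => u (x + h) - u x) <= \sum_(i < N) `|h ord0 i| * n2 (dpart i u).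
Proof.
move=> Hu; have Lu := sobolevH1_Lfun2 Hu.
have Ld i : dpart i u \in L2 by case: (dpartP i Hu).
have LZ i : (fun x => h ord0 i * dpart i u x) \in L2 by exact: Lfun2Z.
have ud := weak_dir_row h Lu Ld (fun i => (dpartP i Hu).2).
apply: (le_trans (n2_shiftB_le Lu (Lfun2_sum _ LZ) ud)).
apply: (le_trans (n2_sum _ LZ)).
by apply: ler_sum => i _; rewrite n2Z.
Qed.

(* If |u(x)| > 2 lam then, for h in the cube Q of side eps, either
   |u(x + h)| >= lam or |u(x + h) - u(x)| >= lam.  As |Q| lam^2 = 2 M exceeds the
   mass of u by M, the second alternative contributes at least M to the integral
   of |u(x + h) - u(x)|^2 over Q. *)
Lemma level_set_bound u (S eps lam M : R) : u \in L2 -> 0 < eps -> 0 < lam ->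
  0 < M -> n2 u ^+ 2 <= M -> eps ^+ N = 2 * M / lam ^+ 2 ->
  (forall h, box 0 (const_mx eps) h -> n2 (fun x => u (x + h) - u x) <= eps * S) ->
  (leb [set x | 2 * lam < `|u x|]%R <= (2 * (eps * S) ^+ 2 / lam ^+ 2)%:E)%E.
Proof.
move=> Lu eps0 lam0 M0 uM epsN HS; have mu := Lfun2_measurable Lu.
pose Q : set 'rV[R]_N := box 0 (const_mx eps).
have mQ : measurable Q by exact: measurable_box.
have lebQ : leb Q = (2 * M / lam ^+ 2)%:E.
  rewrite lebesgue_row_boxE -epsN; congr EFin.
  rewrite (eq_bigr (fun=> eps)) ?prodr_const ?card_ord// => i _.
  by rewrite !mxE subr0 max_r// ltW.
pose f (z : 'rV[R]_N * 'rV[R]_N) : \bar R :=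
  (\1_Q z.2 * (u (z.1 + z.2) - u z.1) ^+ 2)%:E.
have mf : measurable_fun setT f.
  apply/measurable_EFinP; apply: measurable_funM.
    exact: (measurableT_comp (measurable_indic _) measurable_snd).
  apply: measurable_funX; apply: measurable_funB.
    apply: (measurableT_comp mu).
    by apply: measurable_row_add; [exact: measurable_fst|exact: measurable_snd].
  exact: (measurableT_comp mu measurable_fst).
have f0 z : (0 <= f z)%E by rewrite lee_fin mulr_ge0// sqr_ge0.
(* The double integral is at least [M * leb A] in one order and at most [leb Q * (eps * S) ^+ 2] in
   the other; M then cancels. *)
have := fubini_tonelli (m1 := leb) (m2 := leb) f mf f0.
set A := [set x | _].
have mA : measurable A.
  rewrite (_ : A = (fun x => `|u x|) @^-1` `]2 * lam, +oo[); last first.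
    by apply/seteqP; split=> x; rewrite /A /= in_itv/= andbT.
  rewrite -[X in measurable X]setTI.
  have mabs : measurable_fun setT (fun x => `|u x|) by exact: measurableT_comp.
  by apply: mabs => //; exact: measurable_itv.
have mfx x : measurable_fun setT (fun h => f (x, h)).
  exact: (measurableT_comp mf (measurable_pair1 x)).
have mind B : measurable B -> measurable_fun setT (fun x => (\1_B x : R)%:E).
  by move=> mB; apply/measurable_EFinP; exact: measurable_indic.
have Iind (c : R) B : 0 <= c -> measurable B ->
    (\int[leb]_x (c%:E * (\1_B x)%:E) = c%:E * leb B)%E.
  move=> c0 mB; rewrite ge0_integralZl_EFin//; last exact: mind.
  by rewrite integral_indic// setIT.
have EL : (\int[leb]_h (lam ^+ 2 * \1_Q h)%:E = (2 * M)%:E)%E.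
  under eq_integral do rewrite EFinM.
  rewrite Iind ?sqr_ge0// [X in (_ * X)%E]lebQ -EFinM mulrC divfK//.
  by rewrite expf_neq0// gt_eqF.
have HD x : A x -> (M%:E <= \int[leb]_h f (x, h))%E.
  move=> Ax.
  have mux : measurable_fun setT (fun h => u (x + h)).
    by under eq_fun do rewrite addrC; exact: measurable_fun_shift.
  have : (\int[leb]_h (lam ^+ 2 * \1_Q h)%:E <=
      \int[leb]_h (f (x, h) + (u (x + h) ^+ 2)%:E))%E.
    apply: ge0_le_integral => //.
    - by move=> h _; rewrite lee_fin mulr_ge0// sqr_ge0.
    - by apply/measurable_EFinP/measurable_funM => //; exact: measurable_indic.
    - by apply: emeasurable_funD => //; exact/measurable_EFinP/measurable_funX.
    move=> h _; rewrite /f -EFinD lee_fin /= indicE; case: (h \in Q); last first.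
      by rewrite mulr0 mul0r add0r sqr_ge0.
    rewrite mulr1 mul1r; have [ul|ul] := leP lam `|u (x + h)|.
      have : lam ^+ 2 <= u (x + h) ^+ 2.
        rewrite -[leRHS]real_normK ?num_real//; apply: lerXn2r => //.
        by rewrite nnegrE ltW.
      by have := sqr_ge0 (u (x + h) - u x); lra.
    have : lam <= `|u (x + h) - u x|.
      move: Ax; rewrite /A /=; have := ler_normB (u (x + h)) (u (x + h) - u x).
      by rewrite opprB addrC subrK; lra.
    move=> ul'; have : lam ^+ 2 <= (u (x + h) - u x) ^+ 2.
      rewrite -[leRHS]real_normK ?num_real//; apply: lerXn2r => //.
      by rewrite nnegrE ltW.
    by have := sqr_ge0 (u (x + h)); lra.
  rewrite ge0_integralD//; last 2 first.
  - by move=> h _; rewrite lee_fin sqr_ge0.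
  - exact/measurable_EFinP/measurable_funX.
  have -> : (\int[leb]_h (u (x + h) ^+ 2)%:E = (n2 u ^+ 2)%:E)%E.
    rewrite -(n2_sqr_EFin Lu) -[RHS](@ge0_integral_shift _ _ x)//.
    - by apply: eq_integral => h _; rewrite addrC.
    - exact/measurable_EFinP/measurable_funX.
    - by move=> h; rewrite lee_fin sqr_ge0.
  rewrite EL => H; rewrite -(@leeD2rE _ (n2 u ^+ 2)%:E)//; apply: le_trans H.
  by rewrite -EFinD lee_fin; lra.
move=> FT.
have stepA : (M%:E * leb A <= \int[leb]_x \int[leb]_h f (x, h))%E.
  rewrite -(Iind _ _ (ltW M0) mA); apply: ge0_le_integral.
  - exact: measurableT.
  - by move=> x _; apply: mule_ge0; rewrite lee_fin ?indicE// ltW.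
  - by apply: measurable_funeM; exact: mind.
  - exact: measurable_fun_fubini_tonelli_F.
  move=> x _; rewrite indicE; have [/set_mem/HD|_] := boolP (x \in A).
    by rewrite mule1.
  by rewrite mule0; apply: integral_ge0.
have stepQ : (\int[leb]_h \int[leb]_x f (x, h) <=
    \int[leb]_h (((eps * S) ^+ 2)%:E * (\1_Q h)%:E))%E.
  apply: ge0_le_integral.
  - exact: measurableT.
  - by move=> h _; apply: integral_ge0.
  - exact: measurable_fun_fubini_tonelli_G.
  - by apply: measurable_funeM; exact: mind.
  move=> h _; rewrite /f /= indicE; have [/set_mem hQ|_] := boolP (h \in Q).
    rewrite mule1; under eq_integral do rewrite mul1r.
    rewrite n2_sqr_EFin; last exact: (Lfun2B (Lfun2_shift h Lu) Lu).
    have := HS _ hQ; move: (n2_ge0 leb (fun x => u (x + h) - u x)).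
    move: (n2 _) => z z0 zS; rewrite lee_fin.
    by apply: lerXn2r; rewrite ?nnegrE// (le_trans z0).
  by rewrite mule0; under eq_integral do rewrite mul0r; rewrite integral0.
rewrite -FT in stepQ; have := le_trans stepA stepQ.
rewrite (Iind _ _ (sqr_ge0 _) mQ) [X in (_ <= _ * X)%E]lebQ.
rewrite (_ : (_ * (2 * M / _)%:E)%E = (M%:E * (2 * (eps * S) ^+ 2 / lam ^+ 2)%:E)%E).
  by rewrite lee_pmul2l// lte_fin.
by rewrite -!EFinM; congr EFin; ring.
Qed.

End embedding.

Section integrability.
Context (R : realType) (N : nat).
Context (N0 : (0 < N)%N).
Implicit Types (u v w : 'rV[R]_N -> R) (x h : 'rV[R]_N).
Local Notation leb := (@lebesgue_row R N).
Local Notation L2 := (Lfun leb 2%:E).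
Local Notation n2 := (norm2 leb).

Lemma sobolev_integrable_powR u (p : R) : sobolevH1 u -> 2 < p < 2 + 4 / N%:R ->
  leb.-integrable setT (EFin \o (fun x => `|u x| `^ p)).
Proof.
move=> Hu /andP[p2 pN]; have Lu := sobolevH1_Lfun2 Hu.
have N0' : N%:R != 0 :> R by rewrite pnatr_eq0 -lt0n.
pose S : R := \sum_(i < N) n2 (dpart i u).
(* The + 1 keeps M positive even when u is null. *)
pose M : R := n2 u ^+ 2 + 1.
have M0 : 0 < M by rewrite ltr_wpDl// sqr_ge0.
(* With q = 4^(-k) and lam = 2^k / 2 one has lam^(-2) = 4 q and eps^N = 8 M q. The level set bound 2
   (eps S)^2 / lam^2 is then K q^(1 + 2/N), and q^(1 + 2/N) is the k-th power of 2^(-(2 + 4/N)). *)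
pose K : R := 8 * S ^+ 2 * (8 * M) `^ (2 / N%:R).
apply: (@weak_Lp_integrable _ _ _ _ _ _ (2 + 4 / N%:R) K) => // k.
pose q : R := 2 `^ (- (2 * k%:R)).
have q0 : 0 < q by exact: powR_gt0.
pose lam : R := 2 ^+ k / 2.
have lam0 : 0 < lam by rewrite divr_gt0// exprn_gt0.
have lamq : lam ^- 2 = 4 * q.
  have four : 2 ^+ 2 = 4 :> R by ring.
  have -> : q = (4 ^+ k)^-1.
    rewrite /q powRN; congr (_^-1).
    by rewrite powRrM powR_mulrn ?powR_ge0// powR_mulrn// four.
  have k0 : 4 ^+ k != 0 :> R by rewrite expf_neq0// pnatr_eq0.
  by rewrite /lam expr_div_n -exprM mulnC exprM four; field.
pose eps : R := (8 * M * q) `^ N%:R^-1.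
have eps0 : 0 < eps by apply: powR_gt0; rewrite !mulr_gt0.
have epsN : eps ^+ N = 2 * M / lam ^+ 2.
  rewrite lamq /eps -powR_mulrn ?powR_ge0// -powRrM mulVf// powRr1; first ring.
  by rewrite !mulr_ge0// ltW.
have HS h : box 0 (const_mx eps) h -> n2 (fun x => u (x + h) - u x) <= eps * S.
  move=> hQ; apply: (le_trans (n2_shiftB_le_sum h Hu)).
  rewrite /S mulr_sumr; apply: ler_sum => i _; apply: ler_wpM2r; first exact: n2_ge0.
  by have := hQ i; rewrite !mxE => /andP[hi0 hi]; rewrite gtr0_norm// ltW.
have uM : n2 u ^+ 2 <= M by rewrite lerDl.
have := level_set_bound Lu eps0 lam0 M0 uM epsN HS.
have -> : 2 * lam = 2 ^+ k by rewrite /lam mulrC divfK.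
move/le_trans; apply; rewrite lee_fin.
have epsE : eps ^+ 2 = (8 * M) `^ (2 / N%:R) * q `^ (2 / N%:R).
  rewrite /eps -powR_mulrn ?powR_ge0// -powRrM [_^-1 * _]mulrC powRM//.
    by rewrite mulr_ge0// ltW.
  exact: ltW.
have qE : q * q `^ (2 / N%:R) = (2 `^ (- (2 + 4 / N%:R))) ^+ k.
  rewrite -[X in X * _]powRr1 ?(ltW q0)// -powRD; last first.
    by rewrite (gt_eqF q0) implybT.
  rewrite /q -[RHS](powR_mulrn _ (powR_ge0 _ _)) -!powRrM; congr (_ `^ _).
  by field.
rewrite exprMn lamq epsE /K -qE le_eqVlt; apply/orP; left; apply/eqP; ring.
Qed.

(** The product is at most the larger of |u|, |v| raised to r + s, hence at most the sum of the two
    powers. *)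
Lemma integrable_powR_mul u v (r s : R) : measurable_fun setT u ->
  measurable_fun setT v -> 0 <= r -> 0 <= s ->
  leb.-integrable setT (EFin \o (fun x => `|u x| `^ (r + s))) ->
  leb.-integrable setT (EFin \o (fun x => `|v x| `^ (r + s))) ->
  leb.-integrable setT (EFin \o (fun x => `|u x| `^ r * `|v x| `^ s)).
Proof.
move=> mu mv r0 s0 Iu Iv; have Iuv := integrableD measurableT Iu Iv.
have mpow w t : measurable_fun setT w -> measurable_fun setT (fun x => `|w x| `^ t).
  move=> mw; apply: (measurableT_comp (measurable_powR _)).
  exact: measurableT_comp.
apply: le_integrable Iuv => //.
  by apply/measurable_EFinP; apply: measurable_funM; exact: mpow.
move=> x _; rewrite /= lee_fin ger0_norm ?mulr_ge0 ?powR_ge0//.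
rewrite [leRHS]ger0_norm ?addr_ge0 ?powR_ge0//.
have H (a b t t' : R) : 0 <= t -> 0 <= t' -> 0 <= a -> a <= b ->
    a `^ t * b `^ t' <= b `^ (t + t').
  move=> t0 t'0 a0 ab; have b0 := le_trans a0 ab.
  have [b0'|bn0] := eqVneq b 0.
    have a0' : a = 0 by apply/eqP; rewrite eq_le a0 -b0' ab.
    (* Zero to the power zero is 1, so an exponent t = 0 is treated apart. *)
    rewrite a0' b0'; have [->|tn0] := eqVneq t 0; first by rewrite powRr0 mul1r add0r.
    by rewrite powR0// mul0r powR_ge0.
  rewrite powRD ?bn0 ?implybT// ler_wpM2r ?powR_ge0//.
  by apply: ge0_ler_powR.
have [uv|vu] := leP `|u x| `|v x|.
  by have := H _ _ _ _ r0 s0 (normr_ge0 _) uv; move/le_trans; apply; rewrite lerDr powR_ge0.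
rewrite mulrC; have := H _ _ _ _ s0 r0 (normr_ge0 _) (ltW vu).
by move/le_trans; apply; rewrite [s + r]addrC lerDl powR_ge0.
Qed.

Lemma integrable_sum_fun (I : Type) (s : seq I) (F : I -> 'rV[R]_N -> R) :
  (forall i, leb.-integrable setT (EFin \o F i)) ->
  leb.-integrable setT (EFin \o (fun x => \sum_(i <- s) F i x)).
Proof.
move=> IF; rewrite (_ : _ \o _ = (fun x => \sum_(i <- s) (F i x)%:E)%E).
  by apply: integrable_sum => // i _; exact: IF.
by apply/funext => x; rewrite /= sumEFin.
Qed.

Lemma integrable_scale_fun (c : R) (f : 'rV[R]_N -> R) :
  leb.-integrable setT (EFin \o f) ->
  leb.-integrable setT (EFin \o (fun x => c * f x)).
Proof. by move=> If; exact: (integrableZl measurableT c If). Qed.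

Lemma integrable_formG (l m n : nat) (mu p : 'I_l.+1 -> R) (nu q : 'I_m.+1 -> R)
    (beta r1 r2 : 'I_n.+1 -> R) u v :
  condG mu p nu q beta r1 r2 N -> sobolevH1 u -> sobolevH1 v ->
  leb.-integrable setT (EFin \o (fun x => formG mu p nu q beta r1 r2 (u x) (v x))).
Proof.
move=> [Hp Hq Hr] Hu Hv.
have mu' := Lfun2_measurable (sobolevH1_Lfun2 Hu).
have mv' := Lfun2_measurable (sobolevH1_Lfun2 Hv).
pose F1 x := \sum_(i < l.+1) mu i / p i * `|u x| `^ p i.
pose F2 x := \sum_(j < m.+1) nu j / q j * `|v x| `^ q j.
pose F3 x := \sum_(k < n.+1) beta k * `|u x| `^ r1 k * `|v x| `^ r2 k.
suff [I1 I2 I3] : [/\ leb.-integrable setT (EFin \o F1),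
    leb.-integrable setT (EFin \o F2) & leb.-integrable setT (EFin \o F3)].
  exact: (integrableD measurableT (integrableD measurableT I1 I2) I3).
split.
- apply: integrable_sum_fun => i; apply: integrable_scale_fun.
  by apply: sobolev_integrable_powR => //; case: (Hp i).
- apply: integrable_sum_fun => i; apply: integrable_scale_fun.
  by apply: sobolev_integrable_powR => //; case: (Hq i).
apply: integrable_sum_fun => k.
rewrite (_ : (fun _ => _) = (fun x => beta k * (`|u x| `^ r1 k * `|v x| `^ r2 k))); last first.
  by apply/funext => x; rewrite mulrA.
apply: integrable_scale_fun; have [_ r11 r21 r12] := Hr k.
apply: integrable_powR_mul => //; try exact: sobolev_integrable_powR; lra.
Qed.

End integrability.

(** * The nonlinearity *)

Section superadditivity.
Context (R : realType).
Implicit Types a b p : R.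

Local Notation hyp a b := (Num.sqrt (a ^+ 2 + b ^+ 2)).

Lemma hyp_sqr a b : hyp a b ^+ 2 = a ^+ 2 + b ^+ 2.
Proof. by rewrite sqr_sqrtr// addr_ge0 ?sqr_ge0. Qed.

Lemma norm_le_hyp a b : `|a| <= hyp a b.
Proof. by rewrite -sqrtr_sqr ler_sqrt ?addr_ge0 ?sqr_ge0// lerDl sqr_ge0. Qed.

Lemma hypC a b : hyp a b = hyp b a.
Proof. by rewrite addrC. Qed.

Lemma hyp_gt0 a b : (a != 0) || (b != 0) -> 0 < hyp a b.
Proof.
rewrite sqrtr_gt0 lt_def addr_ge0 ?sqr_ge0// andbT.
by rewrite paddr_eq0 ?sqr_ge0// !sqrf_eq0 negb_and.
Qed.

(** With n > 0 both sides vanish at a = 0, whatever the value of the remaining power there. *)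
Lemma powR_splitX (n : nat) a p : (0 < n)%N -> n%:R <= p -> 0 <= a ->
  a `^ p = a ^+ n * a `^ (p - n%:R).
Proof.
move=> n0 np a0; have [->|an0] := eqVneq a 0.
  by rewrite expr0n gtn_eqF// mul0r powR0// gt_eqF// (lt_le_trans _ np)// ltr0n.
by rewrite -powR_mulrn// -powRD ?an0 ?implybT// subrKC.
Qed.

(** One square is factored out: h^p = (a^2 + b^2) h^(p-2), and h^(p-2) dominates |a|^(p-2) and
    |b|^(p-2). *)
Lemma powR_hyp_ge a b p : 2 <= p -> `|a| `^ p + `|b| `^ p <= hyp a b `^ p.
Proof.
move=> p2; have h0 : 0 <= hyp a b by exact: sqrtr_ge0.
have split2 c : 0 <= c -> c `^ p = c ^+ 2 * c `^ (p - 2%:R) by exact: powR_splitX.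
rewrite (split2 _ (normr_ge0 a)) (split2 _ (normr_ge0 b)) (split2 _ h0).
rewrite hyp_sqr mulrDl (real_normK (num_real a)) (real_normK (num_real b)).
have p20 : 0 <= p - 2%:R by rewrite subr_ge0.
apply: lerD; apply: ler_wpM2l; rewrite ?sqr_ge0//; apply: ge0_ler_powR;
  rewrite ?nnegrE// ?norm_le_hyp//.
by rewrite hypC norm_le_hyp.
Qed.

(** The same factorization; |a| and |b| are now strictly below h, and p - 2 > 0 preserves
    strictness. *)
Lemma powR_hyp_gt a b p : 2 < p -> a != 0 -> b != 0 ->
  `|a| `^ p + `|b| `^ p < hyp a b `^ p.
Proof.
move=> p2 a0 b0; have h0 : 0 <= hyp a b by exact: sqrtr_ge0.
have p2' := ltW p2.
have lt_hyp c e : e != 0 -> `|c| < hyp c e.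
  move=> e0; have e2 : 0 < e ^+ 2 by rewrite lt_def sqrf_eq0 e0 sqr_ge0.
  by rewrite -sqrtr_sqr ltr_sqrt ?ltrDl// ltr_wpDl ?sqr_ge0.
have split2 c : 0 <= c -> c `^ p = c ^+ 2 * c `^ (p - 2%:R) by exact: powR_splitX.
rewrite (split2 _ (normr_ge0 a)) (split2 _ (normr_ge0 b)) (split2 _ h0).
rewrite hyp_sqr mulrDl (real_normK (num_real a)) (real_normK (num_real b)).
have p20 : 0 < p - 2%:R by rewrite subr_gt0.
have pos (c : R) : c != 0 -> 0 < c ^+ 2 by move=> c0; rewrite lt_def sqrf_eq0 c0 sqr_ge0.
apply: ltrD; (rewrite ltr_pM2l; last exact: pos); apply: gt0_ltr_powR;
  rewrite ?nnegrE// ?lt_hyp//.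
by rewrite hypC lt_hyp.
Qed.

(** One factor of each base goes into Cauchy-Schwarz, |a1 a2| + |b1 b2| <= H1 H2; the remaining
    exponents r - 1 and s - 1 are nonnegative, so monotonicity handles them. *)
Lemma powR_hyp_mul_ge a1 a2 b1 b2 (r s : R) : 1 <= r -> 1 <= s ->
  `|a1| `^ r * `|a2| `^ s + `|b1| `^ r * `|b2| `^ s <=
  hyp a1 b1 `^ r * hyp a2 b2 `^ s.
Proof.
move=> r1 s1; set H1 := hyp a1 b1; set H2 := hyp a2 b2.
have h1 : 0 <= H1 by exact: sqrtr_ge0.
have h2 : 0 <= H2 by exact: sqrtr_ge0.
have r0 : 0 <= r - 1%:R by rewrite subr_ge0.
have s0 : 0 <= s - 1%:R by rewrite subr_ge0.
have CS : `|a1| * `|a2| + `|b1| * `|b2| <= H1 * H2.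
  rewrite /H1 /H2 -sqrtrM ?addr_ge0 ?sqr_ge0//.
  rewrite -[leLHS]ger0_norm ?addr_ge0 ?mulr_ge0// -sqrtr_sqr ler_sqrt.
    rewrite -(real_normK (num_real a1)) -(real_normK (num_real a2)).
    rewrite -(real_normK (num_real b1)) -(real_normK (num_real b2)).
    by have := sqr_ge0 (`|a1| * `|b2| - `|b1| * `|a2|); lra.
  by rewrite mulr_ge0 ?addr_ge0 ?sqr_ge0.
have split1 (t c : R) : 1 <= t -> 0 <= c -> c `^ t = c * c `^ (t - 1%:R).
  by move=> t1 c0; exact: (@powR_splitX 1 c t (ltn0Sn 0) t1 c0).
rewrite (split1 r _ r1 (normr_ge0 a1)) (split1 r _ r1 (normr_ge0 b1)) (split1 r _ r1 h1).
rewrite (split1 s _ s1 (normr_ge0 a2)) (split1 s _ s1 (normr_ge0 b2)) (split1 s _ s1 h2).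
have P1 c d e : `|c| <= e -> 0 <= d -> `|c| `^ d <= e `^ d.
  by move=> ce d0; apply: ge0_ler_powR; rewrite ?nnegrE// (le_trans _ ce).
have A1 : `|a1| `^ (r - 1%:R) <= H1 `^ (r - 1%:R) by apply: P1 => //; exact: norm_le_hyp.
have A2 : `|a2| `^ (s - 1%:R) <= H2 `^ (s - 1%:R) by apply: P1 => //; exact: norm_le_hyp.
have B1 : `|b1| `^ (r - 1%:R) <= H1 `^ (r - 1%:R).
  by apply: P1 => //; rewrite /H1 hypC norm_le_hyp.
have B2 : `|b2| `^ (s - 1%:R) <= H2 `^ (s - 1%:R).
  by apply: P1 => //; rewrite /H2 hypC norm_le_hyp.
rewrite mulrACA [X in _ + X]mulrACA [leRHS]mulrACA.
apply: (le_trans _ (ler_wpM2r _ CS)); last by rewrite mulr_ge0 ?powR_ge0.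
rewrite mulrDl; apply: lerD; (apply: ler_wpM2l; first exact: mulr_ge0).
  exact: (ler_pM (powR_ge0 _ _) (powR_ge0 _ _) A1 A2).
exact: (ler_pM (powR_ge0 _ _) (powR_ge0 _ _) B1 B2).
Qed.

Lemma ltr_sum_one n (F H : 'I_n.+1 -> R) : (forall i, F i <= H i) ->
  F ord0 < H ord0 -> \sum_(i < n.+1) F i < \sum_(i < n.+1) H i.
Proof.
move=> FH FH0; rewrite (bigD1 ord0)// [ltRHS](bigD1 ord0)//=.
by rewrite ltr_leD// ler_sum.
Qed.

Section formG.
Context (l m n N : nat) (mu p : 'I_l.+1 -> R) (nu q : 'I_m.+1 -> R).
Context (beta r1 r2 : 'I_n.+1 -> R) (cG : condG mu p nu q beta r1 r2 N).
Local Notation G := (formG mu p nu q beta r1 r2).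

(** Strictness: if both pairs are nonzero in a common component, a pure power is strict there.
    Otherwise they live in opposite components; both coupling products vanish on the left, while H1
    and H2 are positive, so the coupling term is strict. One strict index per sum is enough, and
    [ord0] always exists. *)
Lemma formG_superadditive a1 a2 b1 b2 :
  G a1 a2 + G b1 b2 <= G (hyp a1 b1) (hyp a2 b2) /\
  ((a1 != 0) || (a2 != 0) -> (b1 != 0) || (b2 != 0) ->
   G a1 a2 + G b1 b2 < G (hyp a1 b1) (hyp a2 b2)).
Proof.
have [Hp Hq Hr] := cG.
have hn a b : `|hyp a b| = hyp a b by rewrite ger0_norm// sqrtr_ge0.
have mup i : 0 < mu i / p i.
  by have [mu0 /andP[p2 _]] := Hp i; rewrite divr_gt0// (lt_trans _ p2).
have nuq j : 0 < nu j / q j.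
  by have [nu0 /andP[q2 _]] := Hq j; rewrite divr_gt0// (lt_trans _ q2).
pose P (c d : R) := \sum_(i < l.+1) mu i / p i * (`|c| `^ p i + `|d| `^ p i).
pose Q (c d : R) := \sum_(j < m.+1) nu j / q j * (`|c| `^ q j + `|d| `^ q j).
pose B := \sum_(k < n.+1) beta k *
  (`|a1| `^ r1 k * `|a2| `^ r2 k + `|b1| `^ r1 k * `|b2| `^ r2 k).
have -> : G a1 a2 + G b1 b2 = P a1 b1 + Q a2 b2 + B.
  rewrite /formG addrACA [X in X + _ = _]addrACA -!big_split/=.
  congr (_ + _ + _); apply: eq_bigr => i _; ring.
rewrite /formG !hn.
set P' := \sum_(i < l.+1) _; set Q' := \sum_(i < m.+1) _; set B' := \sum_(i < n.+1) _.
have Pi i : mu i / p i * (`|a1| `^ p i + `|b1| `^ p i) <= mu i / p i * hyp a1 b1 `^ p i.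
  have [_ /andP[p2 _]] := Hp i.
  by apply: ler_wpM2l; [exact: ltW|apply: powR_hyp_ge; exact: ltW].
have Qj j : nu j / q j * (`|a2| `^ q j + `|b2| `^ q j) <= nu j / q j * hyp a2 b2 `^ q j.
  have [_ /andP[q2 _]] := Hq j.
  by apply: ler_wpM2l; [exact: ltW|apply: powR_hyp_ge; exact: ltW].
have Bk k : beta k * (`|a1| `^ r1 k * `|a2| `^ r2 k + `|b1| `^ r1 k * `|b2| `^ r2 k) <=
    beta k * hyp a1 b1 `^ r1 k * hyp a2 b2 `^ r2 k.
  have [b0 r11 r21 _] := Hr k.
  by rewrite -mulrA; apply: ler_wpM2l; [exact: ltW|apply: powR_hyp_mul_ge; exact: ltW].
have PP' : P a1 b1 <= P' by apply: ler_sum.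
have QQ' : Q a2 b2 <= Q' by apply: ler_sum.
have BB' : B <= B' by apply: ler_sum.
split=> [|a0 b0]; first by rewrite !lerD.
suff : [\/ P a1 b1 < P', Q a2 b2 < Q' | B < B'] by case=> ?; lra.
have [ab1|] := boolP ((a1 != 0) && (b1 != 0)).
  case/andP: ab1 => a10 b10; apply: Or31; apply: ltr_sum_one => //.
  have [_ /andP[p2 _]] := Hp ord0.
  by rewrite ltr_pM2l//; exact: powR_hyp_gt.
have [ab2 _|] := boolP ((a2 != 0) && (b2 != 0)).
  case/andP: ab2 => a20 b20; apply: Or32; apply: ltr_sum_one => //.
  have [_ /andP[q2 _]] := Hq ord0.
  by rewrite ltr_pM2l//; exact: powR_hyp_gt.
move=> ab2 ab1; apply: Or33; apply: ltr_sum_one => //.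
have [b0' r11 r21 _] := Hr ord0; rewrite -mulrA ltr_pM2l//.
have r1n : r1 ord0 != 0 by rewrite gt_eqF// (lt_trans _ r11).
have r2n : r2 ord0 != 0 by rewrite gt_eqF// (lt_trans _ r21).
have H0 : 0 < hyp a1 b1 `^ r1 ord0 * hyp a2 b2 `^ r2 ord0.
  rewrite mulr_gt0// powR_gt0// hyp_gt0//.
    by move: a0 b0 ab1 ab2; do 4 case: eqP => //.
  by move: a0 b0 ab1 ab2; do 4 case: eqP => //.
suff -> : `|a1| `^ r1 ord0 * `|a2| `^ r2 ord0 + `|b1| `^ r1 ord0 * `|b2| `^ r2 ord0 = 0.
  exact: H0.
move: a0 b0 ab1 ab2.
have [->|a1n] := eqVneq a1 0; have [->|b1n] := eqVneq b1 0;
have [->|a2n] := eqVneq a2 0; have [->|b2n] := eqVneq b2 0 => //= _ _ _ _;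
by rewrite !normr0 !powR0// !(mul0r, mulr0) addr0.
Qed.

End formG.
End superadditivity.

(** * Positive integrals, overlapping translates and the energy comparison *)

Section general_measure.
Context d (T : measurableType d) (R : realType) (mu : {measure set T -> \bar R}).
Implicit Types f g : T -> R.

(* Holds without any measurability: the integral of a nonnegative function is a
   supremum over the simple functions below it. *)
Lemma ge0_le_integral_any (f g : T -> \bar R) : (forall x, 0 <= f x)%E ->
  (forall x, f x <= g x)%E -> (\int[mu]_x f x <= \int[mu]_x g x)%E.
Proof.
move=> f0 fg; have g0 x : (0 <= g x)%E by exact: le_trans (fg x).
rewrite !ge0_integralTE//; apply: ub_ereal_sup => _ [h hf <-].
by apply: ereal_sup_ubound; exists h => // x; exact: le_trans (hf x) (fg x).
Qed.

Lemma Rintegral_gt0 f (A : set T) : (forall x, 0 <= f x) ->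
  mu.-integrable setT (EFin \o f) -> measurable A -> (0 < mu A)%E ->
  (forall x, A x -> 0 < f x) -> 0 < \int[mu]_x f x.
Proof.
move=> f0 If mA A0 fA; rewrite lt_def Rintegral_ge0// andbT.
apply: contraTneq A0 => int0; rewrite -leNgt.
have [mf _] := integrableP _ _ _ If.
have : (\int[mu]_x `|(f x)%:E| = 0)%E.
  under eq_integral do rewrite gee0_abs ?lee_fin//.
  have := integrable_fin_num measurableT If.
  by move=> /fineK <-; congr EFin; exact: int0.
move/(ae_eq_integral_abs mu measurableT mf) => [Z [mZ Z0 fZ]].
rewrite -Z0; apply: le_measure; rewrite ?inE// => x Ax; apply: fZ => /= /(_ I) /eqP.
by rewrite eqe gt_eqF// fA.
Qed.

End general_measure.

Section overlap.
Context (R : realType) (N : nat).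
Implicit Types (u v w phi V : 'rV[R]_N -> R) (x y h : 'rV[R]_N).
Local Notation leb := (@lebesgue_row R N).

(** By Tonelli and translation invariance, the integral over y of the measure of the overlap is
    [leb A * leb B]. *)
Lemma exists_shift_meet (A B : set 'rV[R]_N) : measurable A -> measurable B ->
  (0 < leb A)%E -> (0 < leb B)%E ->
  exists y, (0 < leb (A `&` [set x | B (x + y)%R]))%E.
Proof.
move=> mA mB A0 B0; apply: contrapT => H.
have H0 y : leb (A `&` [set x | B (x + y)]) = 0%E.
  apply/eqP; rewrite eq_le measure_ge0 andbT leNgt; apply/negP => ?.
  by apply: H; exists y.
pose f (z : 'rV[R]_N * 'rV[R]_N) : \bar R := (\1_A z.1 * \1_B (z.1 + z.2))%:E.
have mf : measurable_fun setT f.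
  apply/measurable_EFinP; apply: measurable_funM.
    exact: (measurableT_comp (measurable_indic mA) measurable_fst).
  apply: (measurableT_comp (measurable_indic mB)).
  by apply: measurable_row_add; [exact: measurable_fst|exact: measurable_snd].
have f0 z : (0 <= f z)%E by rewrite lee_fin mulr_ge0.
have := fubini_tonelli (m1 := leb) (m2 := leb) f mf f0.
have mshift y : measurable [set x | B (x + y)].
  by rewrite -[X in measurable X]setTI; exact: (measurable_shift y measurableT mB).
have -> : (\int[leb]_y \int[leb]_x f (x, y) = 0)%E.
  apply: integral0_eq => y _; rewrite -(H0 y) -[in RHS](setIT (A `&` _)).
  rewrite -integral_indic//; last exact: measurableI.
  by apply: eq_integral => x _; rewrite /f /= indicI.
have -> : (\int[leb]_x \int[leb]_y f (x, y) = leb A * leb B)%E.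
  have E x : (\int[leb]_y f (x, y) = leb B * (\1_A x)%:E)%E.
    rewrite /f /=; under eq_integral do rewrite EFinM.
    rewrite ge0_integralZl_EFin//; last first.
      apply/measurable_EFinP; apply: (measurableT_comp (measurable_indic mB)).
      by apply: measurable_row_add.
    rewrite muleC; congr (_ * _)%E.
    rewrite -[in RHS](setIT B) -integral_indic//.
    rewrite -(@ge0_integral_shift _ _ x (fun y => (\1_B y)%:E))//.
      by apply: eq_integral => y _; rewrite addrC.
    exact/measurable_EFinP/measurable_indic.
  under eq_integral do rewrite E.
  rewrite ge0_integralZl//; last exact/measurable_EFinP/measurable_indic.
  by rewrite integral_indic// setIT muleC.
by move/eqP; rewrite mule_eq0 !gt_eqF.
Qed.

Definition nonzero_set u v := [set x | (u x != 0) || (v x != 0)].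

Lemma measurable_nonzero_set u v : measurable_fun setT u ->
  measurable_fun setT v -> measurable (nonzero_set u v).
Proof.
move=> mu mv; rewrite (_ : nonzero_set u v = ~` (u @^-1` [set 0] `&` v @^-1` [set 0])).
  apply: measurableC; apply: measurableI; rewrite -[X in measurable X]setTI.
    exact: mu.
  exact: mv.
apply/seteqP; split=> x; rewrite /nonzero_set /=.
  by move=> /orP[/eqP u0|/eqP v0] [].
by move=> H; rewrite -negb_and; apply/negP => /andP[/eqP ? /eqP ?]; exact: H.
Qed.

Lemma nonzero_set_gt0 u v : measurable_fun setT u -> measurable_fun setT v ->
  ~ ({ae leb, forall x, u x = 0} /\ {ae leb, forall x, v x = 0}) ->
  (0 < leb (nonzero_set u v))%E.
Proof.
move=> mu mv H; rewrite lt_def measure_ge0 andbT; apply/eqP => Z0; apply: H.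
have mZ := measurable_nonzero_set mu mv.
split; exists (nonzero_set u v); split => // x /= /eqP n0; rewrite /nonzero_set /=.
  by rewrite n0.
by rewrite n0 orbT.
Qed.

(** V is measurable only for the completed sigma-algebra, hence the comparison through
    [ge0_le_integral_any]. Finiteness for phi matters because [fine] would send an infinite integral
    to 0 and reverse the inequality. *)
Lemma potential_le V u phi : (forall x, V x <= 0) -> L2_weight V phi ->
  (forall x, u x ^+ 2 <= phi x ^+ 2) ->
  \int[leb]_x (V x * phi x ^+ 2) <= \int[leb]_x (V x * u x ^+ 2).
Proof.
move=> V0 phioo uphi.
have E f : \int[leb]_x (V x * f x ^+ 2) = - fine (\int[leb]_x (- V x * f x ^+ 2)%:E)%E.
  rewrite -fineN -integral_ge0N; last first.
    by move=> x _; rewrite lee_fin mulr_ge0 ?sqr_ge0// oppr_ge0.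
  by congr fine; apply: eq_integral => x _; rewrite -EFinN mulNr opprK.
rewrite !E lerN2.
have W0 f x : (0 <= (- V x * f x ^+ 2)%:E)%E.
  by rewrite lee_fin mulr_ge0 ?sqr_ge0// oppr_ge0.
have le : (\int[leb]_x (- V x * u x ^+ 2)%:E <= \int[leb]_x (- V x * phi x ^+ 2)%:E)%E.
  apply: ge0_le_integral_any => // x.
  by rewrite lee_fin ler_wpM2l// oppr_ge0.
have fin_phi : (\int[leb]_x (- V x * phi x ^+ 2)%:E)%E \is a fin_num.
  by rewrite ge0_fin_numE// integral_ge0.
apply: fine_le => //; rewrite ge0_fin_numE ?integral_ge0//.
exact: le_lt_trans le phioo.
Qed.

End overlap.

(** Here gp, gu, gw stand for the integrals of G, the letters e, a, b for the squared gradient norms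
    of phi, u, w, and vp, vu for the potential terms. *)
Lemma energy_lt (R : realType) (gp gu gw e1 e2 a1 a2 b1 b2 vp1 vp2 vu1 vu2 : R) :
  0 < gp - (gu + gw) ->
  vp1 <= vu1 -> vp2 <= vu2 -> e1 <= a1 + b1 -> e2 <= a2 + b2 ->
  2^-1 * (e1 + e2) - gp + 2^-1 * (vp1 + vp2) <
  2^-1 * (a1 + a2) - gu + 2^-1 * (vu1 + vu2) + (2^-1 * (b1 + b2) - gw).
Proof. lra. Qed.

Theorem proposition6p4 (R : realType) (N : nat) (V1 V2 : 'rV[R]_N -> R)
    (l m n : nat) (mu p : 'I_l.+1 -> R) (nu q : 'I_m.+1 -> R)
    (beta r1 r2 : 'I_n.+1 -> R) (lambda1 lambda2 : R)
    (u1 u2 w1 w2 : 'rV[R]_N -> R) :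
  (1 <= N)%N ->
  VH1 V1 -> VH1 V2 ->
  condG mu p nu q beta r1 r2 N ->
  (forall i, p ord0 <= p i) -> (forall j, q ord0 <= q j) ->
  (forall k, r1 ord0 <= r1 k) -> (forall k, r2 ord0 <= r2 k) ->
  0 < lambda1 -> lambda1 <= lambda2 ->
  let G := formG mu p nu q beta r1 r2 in
  nonneg_nonzero_solution G V1 V2 lambda1 lambda2 u1 u2 ->
  nonneg_nonzero_solution G (cst 0) (cst 0) lambda1 lambda2 w1 w2 ->
  exists phi1 phi2 : 'rV[R]_N -> R,
    [/\ sobolevH1 phi1 /\ sobolevH1 phi2,
        normL2 phi1 ^+ 2 = normL2 u1 ^+ 2 + normL2 w1 ^+ 2,
        normL2 phi2 ^+ 2 = normL2 u2 ^+ 2 + normL2 w2 ^+ 2 &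
        energyJ G V1 V2 phi1 phi2 < energyJ G V1 V2 u1 u2 + energyI G w1 w2].
Proof.
move=> N1 [_ V10 _ _ V1H] [_ V20 _ _ V2H] cG _ _ _ _ _ _ G.
move=> [[Hu1 Hu2] nu0 _ _ _] [[Hw1 Hw2] nw0 _ _ _].
have [Lu1 Lu2] := (sobolevH1_Lfun2 Hu1, sobolevH1_Lfun2 Hu2).
have [Lw1 Lw2] := (sobolevH1_Lfun2 Hw1, sobolevH1_Lfun2 Hw2).
have [mu1 mu2] := (Lfun2_measurable Lu1, Lfun2_measurable Lu2).
have [mw1 mw2] := (Lfun2_measurable Lw1, Lfun2_measurable Lw2).
have mA := measurable_nonzero_set mu1 mu2.
have mB := measurable_nonzero_set mw1 mw2.
(* This y makes the set where both pairs are nonzero non-null, the source of the strict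
   inequality. *)
have [y Ay] := exists_shift_meet mA mB (nonzero_set_gt0 mu1 mu2 nu0)
  (nonzero_set_gt0 mw1 mw2 nw0).
have mBy : measurable [set x | nonzero_set w1 w2 (x + y)].
  by rewrite -[X in measurable X]setTI; exact: (measurable_shift y measurableT mB).
have Hw1y := sobolevH1_shift y Hw1; have Hw2y := sobolevH1_shift y Hw2.
have [Lw1y Lw2y] := (sobolevH1_Lfun2 Hw1y, sobolevH1_Lfun2 Hw2y).
set phi1 := modulus u1 (fun x => w1 (x + y)).
set phi2 := modulus u2 (fun x => w2 (x + y)).
have Hphi1 : sobolevH1 phi1 := sobolevH1_modulus Hu1 Hw1y.
have Hphi2 : sobolevH1 phi2 := sobolevH1_modulus Hu2 Hw2y.
have normE u w : sobolevH1 u -> sobolevH1 w ->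
    normL2 (modulus u (fun x => w (x + y))) ^+ 2 = normL2 u ^+ 2 + normL2 w ^+ 2.
  move=> Hu Hw; have [Lu Lw] := (sobolevH1_Lfun2 Hu, sobolevH1_Lfun2 Hw).
  have Lwy := Lfun2_shift y Lw.
  rewrite (normL2_sqr Lu) (normL2_sqr Lw) (normL2_sqr (modulus_Lfun2 Lu Lwy)).
  by rewrite (n2_modulus Lu Lwy) (n2_shift y Lw).
exists phi1, phi2; split; [by []|exact: normE|exact: normE|].
have sqr_le (u w : 'rV[R]_N -> R) x : u x ^+ 2 <= modulus u w x ^+ 2.
  by rewrite hyp_sqr lerDl sqr_ge0.
have P1 := potential_le V10 (V1H _ Hphi1) (sqr_le u1 (fun x => w1 (x + y))).
have P2 := potential_le V20 (V2H _ Hphi2) (sqr_le u2 (fun x => w2 (x + y))).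
have D1 := normL2_grad_modulus y Hu1 Hw1.
have D2 := normL2_grad_modulus y Hu2 Hw2.
have Iu := integrable_formG N1 cG Hu1 Hu2.
have Iw := integrable_formG N1 cG Hw1 Hw2.
have Iwy := integrable_formG N1 cG Hw1y Hw2y.
have Iphi := integrable_formG N1 cG Hphi1 Hphi2.
have IGw := Rintegral_shift y Iw.
(* The gap in G is nonnegative everywhere and positive on the overlap. Integrability of its three
   terms later splits this integral, and the translate of w is moved back by [IGw]. *)
have Gt : 0 < \int[lebesgue_row N]_x
   (G (phi1 x) (phi2 x) - (G (u1 x) (u2 x) + G (w1 (x + y)) (w2 (x + y)))).
  apply: (Rintegral_gt0 _ _ (measurableI _ _ mA mBy) Ay).
  - by move=> x; rewrite subr_ge0; case: (formG_superadditive cG (u1 x) (u2 x)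
      (w1 (x + y)) (w2 (x + y))).
  - exact: (integrableB measurableT Iphi (integrableD measurableT Iu Iwy)).
  move=> x [ux wx]; rewrite subr_gt0.
  by have [_] := formG_superadditive cG (u1 x) (u2 x) (w1 (x + y)) (w2 (x + y)); exact.
have Iuw := integrableD measurableT Iu Iwy.
have EB := RintegralB measurableT Iphi Iuw.
have ED := RintegralD measurableT Iu Iwy.
apply: energy_lt P1 P2 D1 D2.
by rewrite -IGw -ED -EB.
Qed.
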